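(* Let $n\ge 3$ and let $\alpha=(\alpha_1,\ldots,\alpha_n)$ be a multi-index of nonnegative integers. Then, as $|\xi|\to 0$, $\xi\in\mathbb{R}^n$, $$\int_{\partial B(0,1)}x^{\alpha}\,e^{-ix\cdot\xi}\,d\sigma(x)=A_\alpha(\xi)\,\Psi_{(n+|\alpha|+\mu(\alpha^o)-2)/2}(\xi)+o(|\xi|),$$ where $$A_\alpha(\xi)=(2\pi)^{n/2}\Big(\prod_{1\le m\le n,\ \alpha_m^e\ne 0}(\alpha_m^e-1)!!\Big)\Big(\prod_{1\le m\le n,\ \alpha_m^o\ne 0}\alpha_m^o!!\,(-i\,\xi_m)\Big).$$
   Context: $\partial B(0,1)$ is the unit sphere of $\mathbb{R}^n$ and $d\sigma$ its surface area element. For a multi-index $\alpha$ of nonnegative integers, $x^\alpha=x_1^{\alpha_1}\cdots x_n^{\alpha_n}$ and $|\alpha|=\alpha_1+\cdots+\alpha_n$. Set $\alpha^o=(\alpha_1^o,\ldots,\alpha_n^o)$ with $\alpha_j^o=\alpha_j$ if $\alpha_j$ is odd and $\alpha_j^o=0$ otherwise; $\alpha^e=(\alpha_1^e,\ldots,\alpha_n^e)$ with $\alpha_j^e=\alpha_j-\alpha_j^o$; and $\mu(\alpha^o)$ is the number of indices $j$ with $\alpha_j^o\ne 0$. For an odd positive integer $k$, $k!!=k(k-2)\cdots 1$; empty products equal $1$. For $\nu>0$, $\Psi_\nu(\xi)=J_\nu(|\xi|)/|\xi|^\nu$ for $\xi\in\mathbb{R}^n$, where $J_\nu$ is the Bessel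 function of the first kind of order $\nu$; equivalently $$\Psi_\nu(\xi)=2^{-\nu}\sum_{k=0}^\infty\frac{(-1)^k}{k!\,\Gamma(\nu+k+1)}\Big(\frac{|\xi|}{2}\Big)^{2k},$$ which also defines the value at $\xi=0$. The notation $\varphi(\xi)=o(|\xi|)$ as $|\xi|\to 0$ means $\lim_{|\xi|\to0}|\varphi(\xi)|/|\xi|=0$. *)

(* Defs.v *)
From HB Require Import structures.
From mathcomp Require Import all_boot all_order all_algebra.
From mathcomp Require Import all_classical all_reals all_analysis.
From mathcomp Require Export complex.

Set Implicit Arguments.
Unset Strict Implicit.
Unset Printing Implicit Defensive.

Import Order.TTheory GRing.Theory Num.Theory.
Import numFieldNormedType.Exports.

Local Open Scope classical_set_scope.
Local Open Scope ring_scope.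
Local Open Scope complex_scope.

Section Euclidean.
Context {R : realType} {n : nat}.
Implicit Types x y : 'rV[R]_n.

Definition dotrv x y : R := \sum_(j < n) x 0 j * y 0 j.

(* The library norm on 'rV[R]_n is the sup norm. *)
Definition enorm x : R := Num.sqrt (\sum_(j < n) x 0 j ^+ 2).

Definition monomial (alpha : 'I_n -> nat) x : R :=
  \prod_(j < n) x 0 j ^+ alpha j.

End Euclidean.

(* e^{it} *)
Definition expi {R : realType} (t : R) : R[i] := cos t +i* sin t.

Section MultiIndex.
Context {n : nat}.
Implicit Type alpha : 'I_n -> nat.

Definition mlength alpha : nat := (\sum_(j < n) alpha j)%N.
Definition mono_odd alpha (j : 'I_n) : nat :=
  if odd (alpha j) then alpha j else 0%N.
Definition mono_even alpha (j : 'I_n) : nat := (alpha j - mono_odd alpha j)%N.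
Definition mu alpha : nat := #|[set j : 'I_n | alpha j != 0%N]%SET|.

End MultiIndex.

Fixpoint doublefact (k : nat) : nat :=
  match k with
  | j.+2 => (j.+2 * doublefact j)%N
  | _ => 1%N
  end.

Section Bessel.
Context {R : realType}.

Definition Gamma (s : R) : R :=
  (\int[lebesgue_measure]_(t in `]0%R, +oo[) (t `^ (s - 1) * expR (- t)))%R.

(* Bessel function of the first kind of order nu, for x > 0. *)
Definition besselJ (nu x : R) : R :=
  limn (series (fun k : nat =>
    (-1) ^+ k / (k`!%:R * Gamma (nu + k%:R + 1)) * (x / 2) `^ ((2 * k)%:R + nu))).

(* The value at 0 is the constant term of the power series, see Psi_series. *)
Definition Psi {n : nat} (nu : R) (xi : 'rV[R]_n) : R :=
  if xi == 0 then 2 `^ (- nu) / Gamma (nu + 1)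
  else besselJ nu (enorm xi) / enorm xi `^ nu.

End Bessel.

Section SurfaceIntegral.
Context {R : realType}.

(* Lebesgue integral over the box \prod_k [a_k, b_k] of R^m, as an iterated
   integral. *)
Fixpoint box_integral (m : nat) :
    'rV[R]_m -> 'rV[R]_m -> ('rV[R]_m -> R) -> R :=
  match m return 'rV[R]_m -> 'rV[R]_m -> ('rV[R]_m -> R) -> R with
  | 0 => fun _ _ f => f 0
  | m'.+1 => fun (a b : 'rV[R]_(1 + m')) (f : 'rV[R]_(1 + m') -> R) =>
      (\int[lebesgue_measure]_(t in `[a 0 0, b 0 0])
         box_integral (rsubmx a) (rsubmx b)
           (fun u => f (row_mx (t%:M : 'rV[R]_1) u)))%R
  end.

(* Surface area element of a parametrized m-surface X in R^n: the square root
   of the Gram determinant of the partial derivatives of X, which are the rows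
   of the library's Jacobian matrix. *)
Definition area_element (m n : nat) (X : 'rV[R]_m -> 'rV[R]_n) (u : 'rV[R]_m)
    : R :=
  Num.sqrt (\det ('J X u *m ('J X u)^T)).

Definition surface_integral (m n : nat) (X : 'rV[R]_m -> 'rV[R]_n)
    (a b : 'rV[R]_m) (f : 'rV[R]_n -> R) : R :=
  box_integral a b (fun u => f (X u) * area_element X u).

(* Spherical coordinates on the unit sphere of R^n, n >= 2:
   x_j = sin phi_0 ... sin phi_{j-1} cos phi_j for j < n - 1 and
   x_{n-1} = sin phi_0 ... sin phi_{n-2}; the cosine is written as a product
   over the at most one k < n - 1 equal to j. *)
Definition sphere_param (n : nat) (phi : 'rV[R]_n.-1) : 'rV[R]_n :=
  \row_(j < n) ((\prod_(k < n.-1 | (k < j)%N) sin (phi 0 k)) *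
                (\prod_(k < n.-1 | k == j :> nat) cos (phi 0 k))).

(* phi_0, ..., phi_{n-3} range over [0, pi] and phi_{n-2} over [0, 2 pi]. *)
Definition sphere_angle_max (n : nat) : 'rV[R]_n.-1 :=
  \row_(k < n.-1) (if k.+1 == n.-1 then 2 * pi else pi).

Definition sphere_integral (n : nat) (f : 'rV[R]_n -> R) : R :=
  surface_integral (@sphere_param n) 0 (sphere_angle_max n) f.

Definition csphere_integral (n : nat) (f : 'rV[R]_n -> R[i]) : R[i] :=
  sphere_integral (fun x => complex.Re (f x)) +i*
  sphere_integral (fun x => complex.Im (f x)).

End SurfaceIntegral.

Definition A_coef {R : realType} {n : nat} (alpha : 'I_n -> nat)
    (xi : 'rV[R]_n) : R[i] :=
  ((2 * pi) `^ (n%:R / 2))%:C *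
  (\prod_(m < n | mono_even alpha m != 0%N)
     (doublefact (mono_even alpha m - 1))%:R) *
  (\prod_(m < n | mono_odd alpha m != 0%N)
     ((doublefact (mono_odd alpha m))%:R * (- 'i%C * (xi 0 m)%:C))).

Lemma enorm_gt0 {R : realType} {n : nat} (xi : 'rV[R]_n) :
  xi != 0 -> 0 < enorm xi.
Proof.
move=> xi0; rewrite /enorm sqrtr_gt0 lt_def sumr_ge0 => [|j _]; last exact: sqr_ge0.
rewrite andbT; apply: contra xi0; rewrite psumr_eq0 => [/allP h|j _]; last exact: sqr_ge0.
apply/eqP/rowP => j; rewrite mxE; apply/eqP.
by have := h j (mem_index_enum j); rewrite /= expf_eq0.
Qed.

Lemma Psi_series {R : realType} {n : nat} (nu : R) (xi : 'rV[R]_n) :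
  Psi nu xi = 2 `^ (- nu) *
    limn (series (fun k : nat =>
      (-1) ^+ k / (k`!%:R * Gamma (nu + k%:R + 1)) * (enorm xi / 2) ^+ (2 * k))).
Proof.
rewrite /Psi; case: eqVneq => [->|xi0].
  congr (_ * _); apply/esym/cvg_lim => //.
  have -> : enorm (0 : 'rV[R]_n) = 0.
    by rewrite /enorm big1 ?sqrtr0 // => j _; rewrite mxE expr0n.
  apply: cvg_near_cst.
  exists 1%N => // -[//|k] _ /=; rewrite seriesEnat /= big_nat_recl //= big1 => [|j _].
    by rewrite mul0r muln0 expr0 expr0 fact0 ?(mul1r, mulr1, addr0, div1r).
  by rewrite mul0r mulnS expr0n mulr0.
have e0 := enorm_gt0 xi0.
set c := enorm xi in e0 *; set v := fun k : nat => _ * (c / 2) ^+ (2 * k).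
pose d := (c / 2) `^ nu.
have d0 : d != 0 by rewrite gt_eqF // powR_gt0 // divr_gt0.
have -> : besselJ nu c = limn (fun k => d * series v k).
  congr (lim (_ @ \oo)); apply/funext => k; rewrite !seriesEnat /= mulr_sumr.
  apply: eq_bigr => j _; rewrite /v mulrCA -[in RHS]powR_mulrn ?divr_ge0 ?ltW//.
  rewrite /d -powRD ?[nu + _]addrC //; apply/implyP => _.
  by rewrite gt_eqF ?divr_gt0.
have -> : limn (fun k => d * series v k) = d * limn (series v).
  have [cv|ncv] := pselect (cvgn (series v)).
    by apply/cvg_lim => //; apply: cvgMl_tmp.
  rewrite (dvgP ncv) dvgP ?mulr0 // => cv; apply: ncv.
  by rewrite -(is_cvgMlE_tmp _ d0).
rewrite mulrAC; congr (_ * _).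
rewrite /d powRM ?invr_ge0 ?ltW // mulrAC mulfV ?mul1r; last first.
  by rewrite gt_eqF ?powR_gt0.
by rewrite powRN -powR_inv1 // -powRrM mulN1r powRN.
Qed.

(* Main.v *)
(* Expanding exp(-i x.xi) to first order, the integral is
     M(alpha) - i sum_j xi_j M(alpha + e_j) + O(|xi|^2),
   where M(beta) is the integral of x^beta over the sphere.  In spherical
   coordinates M(beta) factors into one-dimensional integrals of
   cos^p sin^q, and the Wallis recursions give
     M(beta) = 2 pi^(n/2) prod_j (beta_j - 1)!! 2^(-|beta|/2) / Gamma((n + |beta|)/2)
   when all beta_j are even, and 0 otherwise.  Hence at most one term of the
   expansion survives: M(alpha) if no alpha_j is odd, the term of index j if
   alpha_j is the only odd entry, none otherwise.  It equals
   A_alpha(xi) Psi_nu(0) in the first two cases; in the third one A_alpha(xi)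
   is itself O(|xi|^2).  Finally Psi_nu(xi) - Psi_nu(0) = O(|xi|^2). *)

Require Import Defs.
From mathcomp Require Import all_boot all_order all_algebra.
From mathcomp Require Import all_classical all_reals all_analysis.
From mathcomp Require Import measurable_realfun ring lra zify.

Set Implicit Arguments.
Unset Strict Implicit.
Unset Printing Implicit Defensive.

Import Order.TTheory GRing.Theory Num.Theory.
Import numFieldNormedType.Exports.

Local Open Scope classical_set_scope.
Local Open Scope ring_scope.
Local Open Scope complex_scope.

(** * The Gamma function at half-integers *)

Section IntervalIntegrals.
Context {R : realType}.
Implicit Types (f F : R -> R) (a b : R).
Notation mu := (@lebesgue_measure R).

(** Default values shape much of the work. [Gamma] is the real part of an extended integral and
    would be 0 if that integral were infinite. The functional equation is therefore derived in the
    extended reals, and the values at 1/2 and 1 then force every value at a positive multiple of 1/2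
    to be positive, hence finite and invertible. The orders and shifts [nu + k + 1] in the statement
    are all of this kind. Similarly [box_integral] is an iterated integral, so linearity needs
    integrable slices; continuity, jointly in all variables, is carried along to supply them.

    The sphere is treated by recursion on the dimension, writing a point as (cos t, sin t y) with y
    on the sphere one dimension lower. Value, Jacobian, Gram matrix and integral all split along
    this decomposition, so no determinant of general size is ever expanded. Half-integer powers of 2
    and pi are kept as natural powers of square roots, which leaves identities that [field] can
    decide. *)

Lemma within_itv_continuous f a b :
  (forall x, a <= x <= b -> {for x, continuous f}) ->
  {within `[a, b], continuous f}.
Proof.
move=> cf; apply: continuous_in_subspaceT => x /set_mem /=.
by rewrite in_itv /=; apply: cf.
Qed.

Lemma integrable_itv_continuous f a b :
  (forall x, a <= x <= b -> {for x, continuous f}) ->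
  mu.-integrable `[a, b] (EFin \o f).
Proof.
move=> cf; apply: continuous_compact_integrable; first exact: segment_compact.
exact: within_itv_continuous.
Qed.

Lemma derivable_oo_LRcontinuous_itv F f a b :
  (forall x, a <= x <= b -> is_derive x (1 : R) F (f x)) -> a <= b ->
  derivable_oo_LRcontinuous F a b.
Proof.
move=> dF ab; have cF x : a <= x <= b -> {for x, continuous F}.
  by move=> /dF d; apply/differentiable_continuous/derivable1_diffP.
split.
- by move=> x; rewrite in_itv /= => /andP[ax xb]; case: (dF x) => //; rewrite !ltW.
- by apply: cvg_at_right_filter; apply: cF; rewrite lexx.
- by apply: cvg_at_left_filter; apply: cF; rewrite lexx andbT.
Qed.

Lemma Rintegral_FTC2 F f a b : a < b ->
  (forall x, a <= x <= b -> {for x, continuous f}) ->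
  (forall x, a <= x <= b -> is_derive x (1 : R) F (f x)) ->
  (\int[mu]_(x in `[a, b]) f x)%R = F b - F a.
Proof.
move=> ab cf dF; rewrite /Rintegral (@continuous_FTC2 R f F a b) //.
- exact: within_itv_continuous.
- by apply: (derivable_oo_LRcontinuous_itv dF); exact: ltW.
- move=> x; rewrite in_itv /= => /andP[ax xb]; rewrite derive1E.
  by have [] : is_derive x (1 : R) F (f x) by apply: dF; rewrite !ltW.
Qed.

(** Monotone convergence along an exhaustion of the open half-line. The values stay in the extended
    reals, so it applies before the limit is known to be finite. *)
Lemma cvg_integral_itv_oy (a b : nat -> R) f :
  (forall n, 0 < a n) -> nonincreasing_seq a -> a n @[n --> \oo] --> (0 : R) ->
  nondecreasing_seq b -> b n @[n --> \oo] --> +oo ->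
  (forall x, 0 < x -> 0 <= f x) -> measurable_fun setT f ->
  (\int[mu]_(x in `[a n, b n]) (f x)%:E)%E @[n --> \oo] -->
  (\int[mu]_(x in `]0%R, +oo[) (f x)%:E)%E.
Proof.
move=> a0 a_dec a_cvg b_inc b_cvg f0 mf.
have -> : `]0%R, +oo[%classic = \bigcup_n `[a n, b n]%classic.
  apply/seteqP; split=> x /=; rewrite in_itv /= ?andbT => x0; last first.
    by case: x0 => n _; rewrite /= in_itv /= => /andP[+ _]; apply: lt_le_trans.
  have : \forall n \near \oo, a n <= x /\ x <= b n.
    near=> n; split; last by near: n; exact: (cvgryPge _).1 b_cvg x.
    near: n; move/cvgrPdist_lt: a_cvg => /(_ _ x0); apply: filterS => n.
    by rewrite sub0r normrN gtr0_norm //; exact: ltW.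
  by case=> n _ /(_ n) /= [] // *; exists n => //=; rewrite in_itv /=; apply/andP.
apply: ge0_nondecreasing_set_cvg_integral => //.
- apply/nondecreasing_seqP => n; rewrite subsetEset => x /=.
  rewrite !in_itv /= => /andP[ax xb]; rewrite (le_trans (a_dec _ _ (leqnSn n))) //.
  by rewrite (le_trans xb) // b_inc.
- by move=> n; apply/measurable_EFinP; exact: measurable_funTS.
- move=> n x; rewrite /= in_itv /= lee_fin => /andP[ax _]; apply: f0.
  exact: lt_le_trans ax.
Unshelve. all: by end_near. Qed.

End IntervalIntegrals.

Section GammaFunction.
Context {R : realType}.
Implicit Types s t : R.
Notation mu := (@lebesgue_measure R).

Let is_derive1_expRN t : is_derive t (1 : R) (fun t => expR (- t)) (- expR (- t)).
Proof. by apply: is_derive_eq; rewrite /GRing.scale /=; ring. Qed.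

(** The Gamma integral before [fine], on which limits can be taken whether or not it is finite. *)
Let eGamma s : \bar R :=
  (\int[mu]_(t in `]0%R, +oo[) (t `^ (s - 1) * expR (- t))%:E)%E.

(* [a n, b n.+1] exhausts ]0, +oo[ and avoids the singularity of the integrand
   at 0 when s < 1. *)
Let a (n : nat) : R := n.+1%:R^-1.
Let b (n : nat) : R := n.+1%:R.

Let a_gt0 n : 0 < a n. Proof. by rewrite invr_gt0. Qed.

Let a_le_b n : a n < b n.+1.
Proof.
by rewrite (@le_lt_trans _ _ 1) ?invf_le1 // ?ler1n // /b ltr1n.
Qed.

Let a_dec : nonincreasing_seq a.
Proof. by move=> m n mn; rewrite lef_pV2 ?posrE // ler_nat ltnS. Qed.

Let b_inc : nondecreasing_seq b.
Proof. by move=> m n mn; rewrite ler_nat ltnS. Qed.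

Let a_cvg : a n @[n --> \oo] --> (0 : R).
Proof. exact: cvg_harmonic. Qed.

Let b_cvg : b n.+1 @[n --> \oo] --> +oo.
Proof.
apply/cvgryPge => A; near=> n; rewrite (@le_trans _ _ n%:R) //; last first.
  by rewrite ler_nat; lia.
by near: n; exact: nbhs_infty_ger.
Unshelve. all: by end_near. Qed.

Let measurable_integrand s :
  measurable_fun setT (fun t : R => t `^ (s - 1) * expR (- t)).
Proof.
apply: measurable_funM; first exact: measurable_powR.
by apply: measurableT_comp => //; exact: measurableT_comp.
Qed.

Let continuous_integrand s t : 0 < t ->
  {for t, continuous (fun t : R => t `^ (s - 1) * expR (- t))}.
Proof.
move=> t0; apply: differentiable_continuous; apply/derivable1_diffP.
apply: derivableM; first by apply: derivable_powR; rewrite in_itv /= t0.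
exact: ex_derive.
Qed.

Let cvg_integrand s :
  (\int[mu]_(t in `[a n, b n.+1]) (t `^ (s - 1) * expR (- t))%:E)%E @[n --> \oo]
  --> eGamma s.
Proof.
apply: (@cvg_integral_itv_oy _ a (fun n => b n.+1)) => //.
- by move=> m n mn; apply: b_inc.
- by move=> x _; rewrite mulr_ge0 ?powR_ge0 ?expR_ge0.
Qed.

Let a_lt n x : a n <= x <= b n.+1 -> 0 < x.
Proof. by case/andP => + _; apply: lt_le_trans. Qed.

(** Integration by parts, obtained from the primitive t^s e^(-t), whose derivative is the difference
    of the two integrands. *)
Let eGamma_step s n :
  (\int[mu]_(t in `[a n, b n.+1]) (t `^ (s + 1 - 1) * expR (- t)))%R =
  s * (\int[mu]_(t in `[a n, b n.+1]) (t `^ (s - 1) * expR (- t)))%R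
  - (b n.+1 `^ s * expR (- b n.+1) - a n `^ s * expR (- a n)).
Proof.
have ci u x : a n <= x <= b n.+1 ->
  {for x, continuous (fun t : R => t `^ (u - 1) * expR (- t))}.
  by move=> /a_lt x0; apply: continuous_integrand.
have -> : b n.+1 `^ s * expR (- b n.+1) - a n `^ s * expR (- a n) =
  (\int[mu]_(t in `[a n, b n.+1])
     (s * (t `^ (s - 1) * expR (- t)) - t `^ (s + 1 - 1) * expR (- t)))%R.
  apply/esym/(@Rintegral_FTC2 _ (fun t => t `^ s * expR (- t))) => //.
  - move=> x hx; apply: cvgB; last exact: ci.
    by apply: cvgM; [exact: cvg_cst|exact: ci].
  - move=> x /a_lt x0; rewrite addrK.
    have := is_deriveM (is_derive1_powR s x0) (is_derive1_expRN x).
    by move/is_derive_eq; apply; rewrite /GRing.scale /=; ring.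
rewrite RintegralB //; first last.
- by apply: integrable_itv_continuous => x /ci.
- apply: integrable_itv_continuous => x /ci cx; apply: cvgM; first exact: cvg_cst.
  exact: cx.
rewrite RintegralZl //; first by rewrite subKr.
by apply: integrable_itv_continuous => x /ci.
Qed.

Let powR_expRN_le s : exists M : R, forall t, 1 <= t -> t `^ s * expR (- t) <= M / t.
Proof.
(* [k] is an integer above |s|, so t^s <= t^k for t >= 1. The term of degree [k.+1] in the
   exponential series leaves one spare power, the factor 1/t. *)
pose k := (Num.truncn `|s|).+1; exists k.+1`!%:R => t t1.
have t0 : 0 < t by exact: lt_le_trans t1.
have h1 : t `^ s <= t ^+ k.
  rewrite -(powR_mulrn _ (ltW t0)); apply: ler_powR => //.
  by rewrite (le_trans (ler_norm _)) // ltW // truncnS_gt.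
have h2 : t ^+ k.+1 / k.+1`!%:R <= expR t.
  apply: le_trans (_ : _ <= 1 + t ^+ k.+1 / k.+1`!%:R) (expR_ge1Dxn k (ltW t0)).
  by rewrite lerDr.
rewrite expRN ler_pdivrMr ?expR_gt0 // mulrAC ler_pdivlMr //.
rewrite (le_trans (ler_wpM2r (ltW t0) h1)) // -exprSr.
by rewrite -ler_pdivrMl ?ltr0n ?fact_gt0 // mulrC.
Qed.

Let boundary_cvg s : 0 < s ->
  b n.+1 `^ s * expR (- b n.+1) - a n `^ s * expR (- a n) @[n --> \oo] --> (0 : R).
Proof.
move=> s0; rewrite -[X in _ --> X]subr0; apply: cvgB.
- have [M hM] := powR_expRN_le s.
  (* [a n.+1] is the inverse of the right endpoint [b n.+1]. *)
  apply: (@squeeze_cvgr _ _ _ _ (cst 0) (fun n => M * a n.+1)).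
  + near=> n; rewrite mulr_ge0 ?powR_ge0 ?expR_ge0 //=.
    by apply: hM; rewrite ler1n.
  + exact: cvg_cst.
  + rewrite -[X in _ --> X](mulr0 M); apply: cvgMl_tmp.
    by rewrite (cvg_shiftS a).
- apply: (@squeeze_cvgr _ _ _ _ (cst 0) (fun n => a n `^ s)).
  + near=> n; rewrite mulr_ge0 ?powR_ge0 ?expR_ge0 //=.
    by rewrite ler_piMr ?powR_ge0 // expR_le1 oppr_le0 ltW.
  + exact: cvg_cst.
  + have := powR_cvg0 s0 => /cvg_at_rightP; apply; split => //.
Unshelve. all: by end_near. Qed.

Lemma GammaS s : 0 < s -> Gamma (s + 1) = s * Gamma s.
Proof.
move=> s0; suff e : eGamma (s + 1) = (s%:E * eGamma s)%E.
  rewrite /Gamma /Rintegral -/(eGamma _) -/(eGamma _) e.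
  have : (0 <= eGamma s)%E.
    by apply: integral_ge0 => t _; rewrite lee_fin mulr_ge0 ?powR_ge0 ?expR_ge0.
  (* A finite value commutes with [fine]; at +oo both sides become 0; -oo is excluded by
     nonnegativity. *)
  by case: (eGamma s) => //=; rewrite ?mulr0 // gt0_muley ?lte_fin //= mulr0.
pose I u n := (\int[mu]_(t in `[a n, b n.+1]) (t `^ (u - 1) * expR (- t))%:E)%E.
have I_fin u n : I u n \is a fin_num.
  apply: integrable_fin_num => //; apply: integrable_itv_continuous => x /a_lt.
  exact: continuous_integrand.
have step n : I (s + 1) n = (s%:E * I s n -
    (b n.+1 `^ s * expR (- b n.+1) - a n `^ s * expR (- a n))%:E)%E.
  rewrite -[LHS]fineK // -[I s n]fineK // -EFinM -EFinB; congr _%:E.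
  exact: eGamma_step.
rewrite -(cvg_lim (@ereal_hausdorff R) (@cvg_integrand (s + 1))).
apply: (cvg_lim (@ereal_hausdorff R)); rewrite -[X in _ --> X]sube0.
rewrite (_ : (fun n => _) = (fun n => s%:E * I s n -
    (b n.+1 `^ s * expR (- b n.+1) - a n `^ s * expR (- a n))%:E)%E); last first.
  by apply/funext => n; exact: step.
apply: cvgeB; first by rewrite fin_num_adde_defl.
  by apply: cvgeZl => //; exact: cvg_integrand.
by apply: cvg_EFin; [near=> n|exact: boundary_cvg].
Unshelve. all: by end_near. Qed.

Lemma Gamma1 : Gamma (1 : R) = 1.
Proof.
rewrite /Gamma /Rintegral -/(eGamma _).
have <- : limn (fun n =>
    (\int[mu]_(t in `[a n, b n.+1]) (t `^ (1 - 1) * expR (- t))%:E)%E) = eGamma 1.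
  exact/cvg_lim/cvg_integrand.
suff -> : limn (fun n =>
  (\int[mu]_(t in `[a n, b n.+1]) (t `^ (1 - 1) * expR (- t))%:E)%E) = 1%:E by [].
have step n : (\int[mu]_(t in `[a n, b n.+1]) (t `^ (1 - 1) * expR (- t))%:E)%E
    = (expR (- a n) - expR (- b n.+1))%:E.
  rewrite -[LHS]fineK; last first.
    apply: integrable_fin_num => //; apply: integrable_itv_continuous => x /a_lt.
    exact: continuous_integrand.
  congr _%:E.
  rewrite -[fine _]/((\int[mu]_(t in `[a n, b n.+1]) (t `^ (1 - 1) * expR (- t)))%R).
  have -> : expR (- a n) - expR (- b n.+1) = - expR (- b n.+1) - - expR (- a n).
    by rewrite opprK addrC.
  apply: (@Rintegral_FTC2 _ (fun t => - expR (- t))) => //.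
  - by move=> x /a_lt x0; exact: continuous_integrand.
  - move=> x _; apply: is_derive_eq.
    by rewrite subrr powRr0 /GRing.scale /=; ring.
under eq_fun do rewrite step.
apply/cvg_lim => //; apply: cvg_EFin; first by near=> n.
rewrite -[X in _ --> X]subr0; apply: cvgB.
  rewrite -[X in _ --> X]expR0 -oppr0.
  apply: continuous_cvg; first exact: continuous_expR.
  exact: cvgN.
rewrite (@cvg_shiftS _ (fun n => expR (- b n))) (@cvg_shiftS _ (fun n => expR (- n%:R))).
exact: cvgn_expR.
Unshelve. all: by end_near. Qed.

(** The substitution t = u^2 leads to the Gaussian integral: t^(-1/2) becomes 1/u and cancels
    against the derivative 2u. The endpoints are squared so that u ranges over [[a n, b n.+1]]. *)
Lemma Gamma_half : Gamma (2^-1 : R) = Num.sqrt pi.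
Proof.
pose J n := (\int[mu]_(t in `[(a n ^+ 2)%R, (b n.+1 ^+ 2)%R])
  (t `^ (2^-1 - 1) * expR (- t))%:E)%E.
have J_cvg : J n @[n --> \oo] --> eGamma 2^-1.
  apply: (@cvg_integral_itv_oy _ (fun n => a n ^+ 2) (fun n => b n.+1 ^+ 2)) => //.
  - by move=> n; rewrite exprn_gt0.
  - by move=> m n mn; rewrite lerXn2r ?nnegrE ?invr_ge0 ?ler0n ?a_dec.
  - by rewrite -[X in _ --> X](mulr0 (0 : R)); exact: (cvgM a_cvg a_cvg).
  - by move=> m n mn; rewrite lerXn2r ?nnegrE ?ler0n //; exact: b_inc.
  - exact: (cvg_comp (fun n => b n.+1) (fun x => x ^+ 2) b_cvg (@cvgr_expr2 R)).
  - by move=> x _; rewrite mulr_ge0 ?powR_ge0 ?expR_ge0.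
have JE n : J n =
    (\int[mu]_(u in `[a n, b n.+1]) (2 * gauss_fun u)%:E)%E.
  have dF (x : R) : is_derive x (1 : R) (fun x => x ^+ 2) (2 * x).
    by apply: is_derive_eq; rewrite /GRing.scale /=; ring.
  have F'E : ((fun x : R => x ^+ 2)^`())%classic = (fun x => 2 * x).
    by apply/funext => x; rewrite derive1E derive_val /GRing.scale /=; ring.
  have c2 : continuous (fun x : R => 2 * x).
    by move=> x; apply: cvgM; [exact: cvg_cst|exact: cvg_id].
  rewrite /J (@integration_by_substitution_increasing _ (fun x => x ^+ 2)) //.
  - apply: eq_integral => x; rewrite inE /= in_itv /= => /a_lt x0.
    congr _%:E; rewrite /gauss_fun !fctE F'E mulrAC mulrCA.
    rewrite -powR_mulrn ?ltW // -powRrM mulrBr mulfV // mulr1.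
    have -> : 1 - 2%:R = - 1 :> R by ring.
    by rewrite powR_inv1 ?ltW // mulVf ?gt_eqF // mulr1.
  - exact: ltW.
  - move=> x y; rewrite !in_itv /= => /a_lt x0 /a_lt y0 xy.
    by rewrite ltrXn2r ?ltW.
  - by move=> x _; rewrite F'E; exact: c2.
  - by rewrite F'E; apply/cvg_ex; exists (2 * a n); apply: cvg_at_right_filter; exact: c2.
  - by rewrite F'E; apply/cvg_ex; exists (2 * b n.+1); apply: cvg_at_left_filter; exact: c2.
  - by apply: (@derivable_oo_LRcontinuous_itv _ _ (fun x => 2 * x)) => //; exact: ltW.
  - apply: within_itv_continuous => x /andP[ax _]; apply: continuous_integrand.
    by apply: lt_le_trans ax; rewrite exprn_gt0.
have : J n @[n --> \oo] --> (Num.sqrt pi)%:E.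
  under eq_fun do rewrite JE.
  have -> : (Num.sqrt pi)%:E = (\int[mu]_(u in `]0%R, +oo[) (2 * gauss_fun u)%:E)%E.
    under eq_integral do rewrite EFinM.
    rewrite ge0_integralZl //; last first.
    - by move=> x _; rewrite lee_fin gauss_fun_ge0.
    - by apply/measurable_EFinP; apply: measurable_funTS; exact: measurable_gauss_fun.
    rewrite integral_itv_obnd_cbnd; last first.
      by apply/measurable_EFinP; apply: measurable_funTS; exact: measurable_gauss_fun.
    by rewrite integral0y_gauss -EFinM; congr _%:E; field.
  apply: (@cvg_integral_itv_oy _ a (fun n => b n.+1)) => //.
  - by move=> m n mn; apply: b_inc.
  - by move=> x _; rewrite mulr_ge0 ?gauss_fun_ge0.
  - by apply: measurable_funM => //; exact: measurable_gauss_fun.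
move=> /(cvg_lim (@ereal_hausdorff R)); rewrite (cvg_lim (@ereal_hausdorff R) J_cvg).
by rewrite /Gamma /Rintegral -/(eGamma _) => ->.
Qed.

End GammaFunction.

(** * Wallis integrals *)

(* The case p = 0 gives doublefact 0 = 1, the subtraction being truncated. *)
Definition even_doublefact {R : realType} (p : nat) : R :=
  if odd p then 0 else (doublefact (p - 1))%:R.

Lemma even_doublefactSS {R : realType} p :
  even_doublefact p.+2 = p.+1%:R * even_doublefact p :> R.
Proof.
rewrite /even_doublefact /= negbK; case: ifP => _; first by rewrite mulr0.
by case: p => [|p]; rewrite ?mul1r // !subn1 /= natrM.
Qed.

Local Opaque Gamma.

Section HalfIntegerGamma.
Context {R : realType}.

(** Indexing by twice the argument turns the functional equation into a step of two on natural
    numbers, in parallel with the Wallis recursions. *)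
Definition half_Gamma (k : nat) : R := Gamma (k%:R / 2).

Lemma half_Gamma1 : half_Gamma 1 = Num.sqrt pi.
Proof. by rewrite /half_Gamma div1r Gamma_half. Qed.

Lemma half_Gamma2 : half_Gamma 2 = 1.
Proof. by rewrite /half_Gamma divff ?Gamma1. Qed.

Lemma half_GammaSS k : half_Gamma k.+3 = k.+1%:R / 2 * half_Gamma k.+1.
Proof.
rewrite /half_Gamma -GammaS; last by rewrite divr_gt0.
congr Gamma.
by rewrite -[k.+3]addn2 natrD; field.
Qed.

(** The functional equation propagates positivity from 1/2 and 1, hence the induction on consecutive
    pairs. Positivity also excludes the default value 0 of an infinite integral. *)
Lemma half_Gamma_gt0 k : 0 < half_Gamma k.+1.
Proof.
suff [] : 0 < half_Gamma k.+1 /\ 0 < half_Gamma k.+2 by [].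
elim: k => [|k [h1 h2]]; last by rewrite half_GammaSS mulr_gt0 ?divr_gt0.
by rewrite half_Gamma1 half_Gamma2 sqrtr_gt0 pi_gt0.
Qed.

End HalfIntegerGamma.

Section TrigonometricIntegrals.
Context {R : realType}.
Notation mu := (@lebesgue_measure R).

Definition trig_integral (c : R) (p q : nat) : R :=
  (\int[mu]_(t in `[0%R, c]) (cos t ^+ p * sin t ^+ q))%R.

(** At exponent 0 the truncated predecessor is multiplied by the coefficient 0. *)
Lemma is_derive_trig_monomial p q (t : R) :
  is_derive t (1 : R) (fun t : R => cos t ^+ p * sin t ^+ q)
    (q%:R * (cos t ^+ p.+1 * sin t ^+ q.-1) - p%:R * (cos t ^+ p.-1 * sin t ^+ q.+1)).
Proof.
rewrite (_ : (fun t : R => _) = cos ^+ p * sin ^+ q); last first.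
  by apply/funext => x; rewrite !fctE.
by apply: is_derive_eq; rewrite /GRing.scale /= !fctE !exprS; ring.
Qed.

Lemma continuous_trig_monomial p q :
  continuous (fun t : R => cos t ^+ p * sin t ^+ q).
Proof.
move=> t; apply: differentiable_continuous; apply/derivable1_diffP.
by case: (is_derive_trig_monomial p q t).
Qed.

Variable c : R.
Hypothesis c0 : 0 < c.
Notation I := (trig_integral c).

Let integrable_trig p q :
  mu.-integrable `[0, c] (EFin \o (fun t : R => cos t ^+ p * sin t ^+ q)).
Proof. by apply: integrable_itv_continuous => x _; exact: continuous_trig_monomial. Qed.

Lemma trig_integral_split p q : I p.+2 q + I p q.+2 = I p q.
Proof.
rewrite /trig_integral -RintegralD //.
congr fine; apply: eq_integral => x _; congr _%:E.
rewrite -[RHS]mul1r -(cos2Dsin2 x) !exprS; ring.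
Qed.

Lemma trig_integral_FTC2 p q :
  q%:R * I p.+1 q.-1 - p%:R * I p.-1 q.+1 =
  cos c ^+ p * sin c ^+ q - cos 0 ^+ p * sin 0 ^+ q.
Proof.
have cZ k u v : continuous (fun t : R => k * (cos t ^+ u * sin t ^+ v)).
  by move=> x; apply: cvgM; [exact: cvg_cst|exact: continuous_trig_monomial].
rewrite /trig_integral -!RintegralZl // -RintegralB //; first last.
- by apply: integrable_itv_continuous => x _; exact: cZ.
- by apply: integrable_itv_continuous => x _; exact: cZ.
apply: (@Rintegral_FTC2 _ (fun t => cos t ^+ p * sin t ^+ q)) => //.
- by move=> x _; apply: cvgB; exact: cZ.
- by move=> x _; exact: is_derive_trig_monomial.
Qed.

Hypothesis sc : sin c = 0.

(** The boundary terms contain sin c or sin 0, so one recursion serves both c = pi and c = 2 pi. *)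
Lemma trig_integral_parts p q : p.+1%:R * I p q.+2 = q.+1%:R * I p.+2 q.
Proof.
have := trig_integral_FTC2 p.+1 q.+1.
by rewrite sc sin0 !expr0n !mulr0 subrr /= => /eqP; rewrite subr_eq0 => /eqP.
Qed.

(** [trig_integral_parts] and [trig_integral_split] form a linear system in the two integrals of
    degree p + q + 2; this and the next lemma solve it. *)
Lemma trig_integral_cosSS p q : I p.+2 q = p.+1%:R / (p + q).+2%:R * I p q.
Proof.
have := trig_integral_parts p q; rewrite -(trig_integral_split p q) => h.
have -> : (p + q).+2%:R = p.+1%:R + q.+1%:R :> R by rewrite -natrD addSn addnS.
have : p.+1%:R + q.+1%:R != 0 :> R by rewrite -natrD pnatr_eq0 addSn.
move=> d; apply: (mulfI d); rewrite mulrA mulrCA mulfV // mulr1 mulrDl mulrDr h; ring.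
Qed.

Lemma trig_integral_sinSS p q : I p q.+2 = q.+1%:R / (p + q).+2%:R * I p q.
Proof.
have := trig_integral_parts p q; rewrite -(trig_integral_split p q) => h.
have -> : (p + q).+2%:R = p.+1%:R + q.+1%:R :> R by rewrite -natrD addSn addnS.
have : p.+1%:R + q.+1%:R != 0 :> R by rewrite -natrD pnatr_eq0 addSn.
move=> d; apply: (mulfI d); rewrite mulrA mulrCA mulfV // mulr1 mulrDl mulrDr h; ring.
Qed.

Lemma trig_integral_cos1 q : I 1 q = 0.
Proof.
have := trig_integral_FTC2 0 q.+1.
rewrite sc sin0 !expr0n !mulr0 subrr mul0r subr0 => /eqP.
by rewrite mulf_eq0 pnatr_eq0 /= => /eqP.
Qed.

Lemma trig_integral_sin1 p : cos c = 1 -> I p 1 = 0.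
Proof.
move=> cc; have := trig_integral_FTC2 p.+1 0.
rewrite cc cos0 !expr0 subrr mul0r sub0r => /eqP.
by rewrite oppr_eq0 mulf_eq0 pnatr_eq0 /= => /eqP.
Qed.

Lemma trig_integral00 : I 0 0 = c.
Proof.
rewrite -[RHS]subr0; apply: (@Rintegral_FTC2 _ id) => //.
  by move=> x _; exact: continuous_trig_monomial.
by move=> x _; apply: is_derive_eq; rewrite !expr0 mulr1.
Qed.

End TrigonometricIntegrals.

Section WallisFormulas.
Context {R : realType}.

Lemma nat_ind2 (P : nat -> Prop) :
  P 0 -> P 1 -> (forall n, P n -> P n.+2) -> forall n, P n.
Proof.
move=> P0 P1 PSS n; suff [] : P n /\ P n.+1 by [].
by elim: n => // n [? ?]; split => //; exact: PSS.
Qed.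

Lemma sqrt2_expSS n : Num.sqrt 2 ^- n.+2 = Num.sqrt 2 ^- n / 2 :> R.
Proof.
by rewrite !exprS mulrA -expr2 sqr_sqrtr ?ler0n // invfM mulrC.
Qed.

Let neq0 k : half_Gamma k.+1 != 0 :> R.
Proof. by rewrite gt_eqF // half_Gamma_gt0. Qed.

(** For even p this is the Beta value B((p+1)/2, (q+1)/2), with Gamma((p+1)/2) written out as
    (p-1)!! sqrt(pi) 2^(-p/2). The factor of q stays a Gamma value because q may be odd here. *)
Lemma trig_integral_pi p q : trig_integral pi p q =
  even_doublefact p * Num.sqrt pi * Num.sqrt 2 ^- p *
  half_Gamma q.+1 / half_Gamma (p + q).+2 :> R.
Proof.
have pi0 := pi_gt0 R; have spi := sinpi R.
elim/nat_ind2: p => [||p IHp].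
- rewrite /even_doublefact /= expr0 invr1 !mulr1 mul1r.
  elim/nat_ind2: q => [||q IH].
  + by rewrite trig_integral00 // half_Gamma1 half_Gamma2 -expr2 sqr_sqrtr ?divr1 // ltW.
  + rewrite half_Gamma2 half_GammaSS half_Gamma1 mulr1 invfM mulrCA mulfV ?mulr1; last first.
      by rewrite gt_eqF ?sqrtr_gt0.
    have := @trig_integral_FTC2 _ _ pi0 1 0.
    rewrite cospi cos0 !expr0 !expr1 mul0r mul1r /= => h.
    have -> : trig_integral pi 0 1 = 2 :> R by lra.
    by field.
  + rewrite (trig_integral_sinSS pi0 spi) IH !add0n half_GammaSS half_GammaSS.
    by field; rewrite neq0 /= gt_eqF // ltr_pwDl.
- by rewrite trig_integral_cos1 // /even_doublefact /= !mul0r.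
- rewrite (trig_integral_cosSS pi0 spi) even_doublefactSS sqrt2_expSS !addSn half_GammaSS IHp.
  field; rewrite neq0 expf_neq0 ?pnatr_eq0 //= ?gt_eqF ?sqrtr_gt0 //.
Qed.

(** Over a full turn odd powers of the sine cancel as well, so both Gamma factors become double
    factorials; for even p and q the value is twice the Beta value. *)
Lemma trig_integral_2pi p q : trig_integral (2 * pi) p q =
  2 * pi * even_doublefact p * even_doublefact q * Num.sqrt 2 ^- (p + q) /
  half_Gamma (p + q).+2 :> R.
Proof.
have pi0 : 0 < 2 * pi :> R by rewrite mulr_gt0 ?pi_gt0.
have spi : sin (2 * pi) = 0 :> R by rewrite mulr_natl sin2pi.
have cpi : cos (2 * pi) = 1 :> R by rewrite mulr_natl cos2pi.
elim/nat_ind2: p => [||p IHp].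
- rewrite add0n; elim/nat_ind2: q => [||q IH].
  + by rewrite trig_integral00 // half_Gamma2 /even_doublefact /= expr0 invr1 !mulr1.
  + by rewrite trig_integral_sin1 // /even_doublefact /= !(mulr0, mul0r).
  + rewrite (trig_integral_sinSS pi0 spi) IH add0n half_GammaSS even_doublefactSS sqrt2_expSS.
    field; rewrite neq0 expf_neq0 ?pnatr_eq0 //= ?gt_eqF ?sqrtr_gt0 //.
- by rewrite trig_integral_cos1 // /even_doublefact /= !(mulr0, mul0r).
- rewrite (trig_integral_cosSS pi0 spi) even_doublefactSS !addSn sqrt2_expSS half_GammaSS IHp.
  field; rewrite neq0 expf_neq0 ?pnatr_eq0 //= ?gt_eqF ?sqrtr_gt0 //.
Qed.

End WallisFormulas.

(** * Iterated integrals over boxes *)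

Section BoxIntegral.
Context {R : realType}.
Notation mu := (@lebesgue_measure R).

Lemma cvg_rV T (F : set_system T) {FF : Filter F} m (g : T -> 'rV[R]_m) (l : 'rV[R]_m) :
  (forall j, g x 0 j @[x --> F] --> l 0 j) -> g x @[x --> F] --> l.
Proof.
move=> cg A [P hP sPA].
have : \forall x \near F, forall j, P 0 j (g x 0 j).
  by apply: filter_forall => j; apply: cg; exact: hP.
by apply: filterS => x hx; apply: sPA => i j; rewrite ord1.
Qed.

Lemma continuous_rV (T : topologicalType) m (g : T -> 'rV[R]_m) :
  (forall j, continuous (fun t => g t 0 j)) -> continuous g.
Proof. by move=> cg t; apply: cvg_rV => j; exact: cg. Qed.

Lemma continuous_pair (S T U : topologicalType) (f : S -> T) (g : S -> U) x :
  {for x, continuous f} -> {for x, continuous g} ->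
  {for x, continuous (fun y => (f y, g y))}.
Proof. by move=> cf cg; exact: cvg_pair. Qed.

Lemma continuous_coord m (j : 'I_m) : continuous (fun u : 'rV[R]_m => u 0 j).
Proof. exact: coord_continuous. Qed.

Lemma continuous_row_mx m :
  continuous (fun p : R * 'rV[R]_m => row_mx (p.1%:M : 'rV[R]_1) p.2).
Proof.
apply: continuous_rV => j; case: (splitP j) => k jk.
- have -> : j = lshift m k by exact: val_inj.
  under eq_fun do rewrite row_mxEl ord1 mxE eqxx mulr1n.
  by move=> p; exact: cvg_fst.
- have -> : j = rshift 1 k by exact: val_inj.
  under eq_fun do rewrite row_mxEr.
  move=> p; apply: (continuous_comp (f := snd) (g := fun u : 'rV[R]_m => u 0 k)).
    exact: cvg_snd.
  exact: continuous_coord.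
Qed.

Lemma Rintegral_itv_cst (a b k : R) : a <= b ->
  (\int[mu]_(t in `[a, b]) k)%R = k * (b - a).
Proof.
rewrite le_eqVlt => /predU1P[->|ab].
  by rewrite set_itv1 Rintegral_set1 subrr mulr0.
rewrite mulrBr; apply: (@Rintegral_FTC2 _ (fun t => k * t)) => //.
  by move=> x _; exact: cvg_cst.
by move=> x _; apply: is_derive_eq; rewrite /GRing.scale /= mulr1 ?mulr0 ?addr0 ?mul0r ?add0r.
Qed.

(** Compactness of [[a, b]] makes H(x, t) close to H(x0, t) uniformly in t once x is near x0. No
    sequences are used, so [T] can be any topological space. *)
Lemma continuous_parametric_integral (T : topologicalType) (H : T * R -> R) a b :
  continuous H -> continuous (fun x => (\int[mu]_(t in `[a, b]) H (x, t))%R).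
Proof.
move=> cH x0; have [ba|ab] := ltP b a.
  have -> : (fun x => (\int[mu]_(t in `[a, b]) H (x, t))%R) = cst 0.
    by apply/funext => x; rewrite set_itv_ge ?Rintegral_set0 // bnd_simp -ltNge.
  exact: cvg_cst.
have ciH x t : {for t, continuous (fun t => H (x, t))}.
  apply: (continuous_comp (g := H)); last exact: cH.
  by apply: continuous_pair; [exact: cvg_cst|exact: cvg_id].
have intH x : mu.-integrable `[a, b] (EFin \o (fun t => H (x, t))).
  by apply: integrable_itv_continuous => t _; exact: ciH.
apply/cvgrPdist_le => e e0.
(* The added 1 keeps the denominator positive when a = b. *)
have d0 : 0 < e / (b - a + 1) by rewrite divr_gt0 // ltr_wpDl // subr_ge0.
have : \forall x \near x0, `[a, b]%classic `<=`
    [set t | `|H (x0, t) - H (x, t)| <= e / (b - a + 1)].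
  have /compact_near_coveringP cK := @segment_compact R a b.
  apply: cK => t _.
  have h1 : \forall p \near (x0, t), `|H (x0, t) - H p| <= e / (b - a + 1) / 2.
    by have /cvgrPdist_le := cH (x0, t); apply; rewrite divr_gt0.
  have h2 : \forall t' \near t, `|H (x0, t) - H (x0, t')| <= e / (b - a + 1) / 2.
    by have /cvgrPdist_le := ciH x0 t; apply; rewrite divr_gt0.
  case: h1 => [[A B] /= [nA nB] AB].
  exists (B `&` [set t' | `|H (x0, t) - H (x0, t')| <= e / (b - a + 1) / 2], A) => /=.
    by split => //; apply: filterI.
  move=> [t' x] /= [[Bt' ht'] Ax].
  have hx := AB (x, t') (conj Ax Bt'); rewrite /= in hx.
  rewrite (splitr (e / (b - a + 1))).
  have -> : H (x0, t') - H (x, t') =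
    (H (x0, t) - H (x, t')) - (H (x0, t) - H (x0, t')) by ring.
  by rewrite (le_trans (ler_normB _ _)) // lerD.
apply: filterS => x hx.
rewrite -RintegralB // (le_trans (le_normr_Rintegral _ _)) //.
  by apply: integrable_itv_continuous => t _; apply: cvgB; exact: ciH.
apply: (@le_trans _ _ (\int[mu]_(t in `[a, b]) (e / (b - a + 1)))%R).
  apply: le_Rintegral => //.
  - apply: integrable_itv_continuous => t _; apply: cvg_norm.
    by apply: cvgB; exact: ciH.
  - by apply: integrable_itv_continuous => t _; exact: cvg_cst.
rewrite Rintegral_itv_cst // mulrAC ler_pdivrMr ?ltr_wpDl ?subr_ge0 // ler_pM2l //.
by rewrite lerDl.
Qed.

(** The parameter space is arbitrary because the induction absorbs the outermost variable into it:
    the hypothesis is applied with [T * R]. *)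
Lemma continuous_box_integral m (T : topologicalType) (a b : 'rV[R]_m)
    (f : T -> 'rV[R]_m -> R) :
  continuous (fun p : T * 'rV[R]_m => f p.1 p.2) ->
  continuous (fun x => box_integral a b (f x)).
Proof.
elim: m T a b f => [|m IH] T a b f cf.
  move=> x; apply: (continuous_comp (f := fun x => (x, 0 : 'rV[R]_0))
    (g := fun p : T * 'rV[R]_0 => f p.1 p.2)); last exact: cf.
  by apply: continuous_pair; [exact: cvg_id|exact: cvg_cst].
rewrite -[m.+1]/(1 + m)%N in a b f cf *.
pose H (p : T * R) := box_integral (rsubmx a) (rsubmx b)
  (fun u => f p.1 (row_mx (p.2%:M : 'rV[R]_1) u)).
suff cH : continuous H.
  exact: (continuous_parametric_integral (a := a 0 0) (b := b 0 0) cH).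
apply: (IH _ _ _ (fun p u => f p.1 (row_mx (p.2%:M : 'rV[R]_1) u))).
move=> p; apply: (continuous_comp
  (f := fun p : T * R * 'rV[R]_m => (p.1.1, row_mx (p.1.2%:M : 'rV[R]_1) p.2))
  (g := fun p : T * 'rV[R]_m.+1 => f p.1 p.2)); last exact: cf.
apply: continuous_pair.
  by apply: (continuous_comp (f := fst) (g := fst)); exact: cvg_fst.
apply: (continuous_comp (f := fun p : T * R * 'rV[R]_m => (p.1.2, p.2))
  (g := fun p : R * 'rV[R]_m => row_mx (p.1%:M : 'rV[R]_1) p.2)); last exact: continuous_row_mx.
apply: continuous_pair; last exact: cvg_snd.
by apply: (continuous_comp (f := fst) (g := snd)); [exact: cvg_fst|exact: cvg_snd].
Qed.

Section Slices.
Variables (m : nat) (a b : 'rV[R]_(1 + m)) (f : 'rV[R]_(1 + m) -> R).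
Hypothesis cf : continuous f.

Lemma continuous_slice t : continuous (fun u => f (row_mx (t%:M : 'rV[R]_1) u)).
Proof.
move=> u; apply: (continuous_comp (f := fun u => row_mx (t%:M : 'rV[R]_1) u)); last exact: cf.
apply: (continuous_comp (f := fun u => (t, u))
  (g := fun p : R * 'rV[R]_m => row_mx (p.1%:M : 'rV[R]_1) p.2)); last exact: continuous_row_mx.
by apply: (continuous_pair (f := cst t) (g := id)); [exact: cst_continuous|exact: cvg_id].
Qed.

(** The outermost variable is taken as the parameter of [continuous_box_integral]; this licenses
    linearity and monotonicity of the outer integral. *)
Lemma integrable_slices c d : mu.-integrable `[c, d] (EFin \o
  (fun t => box_integral (rsubmx a) (rsubmx b)
    (fun u => f (row_mx (t%:M : 'rV[R]_1) u)))).
Proof.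
apply: integrable_itv_continuous => t _.
apply: (@continuous_box_integral _ _ _ _ (fun t u => f (row_mx (t%:M : 'rV[R]_1) u))).
move=> p; apply: (continuous_comp
  (f := fun p : R * 'rV[R]_m => row_mx (p.1%:M : 'rV[R]_1) p.2)); last exact: cf.
exact: continuous_row_mx.
Qed.

End Slices.

Lemma box_integralD m (a b : 'rV[R]_m) (f g : 'rV[R]_m -> R) :
  continuous f -> continuous g ->
  box_integral a b (fun u => f u + g u) = box_integral a b f + box_integral a b g.
Proof.
elim: m a b f g => // m IH a b f g cf cg /=.
rewrite -RintegralD //; last 2 first.
- exact: integrable_slices.
- exact: integrable_slices.
by congr fine; apply: eq_integral => t _; rewrite IH //; exact: continuous_slice.
Qed.

Lemma box_integralZl m (a b : 'rV[R]_m) k (f : 'rV[R]_m -> R) :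
  continuous f -> box_integral a b (fun u => k * f u) = k * box_integral a b f.
Proof.
elim: m a b f => // m IH a b f cf /=.
rewrite -RintegralZl //; last exact: integrable_slices.
by congr fine; apply: eq_integral => t _; rewrite IH //; exact: continuous_slice.
Qed.

Lemma box_integral_prod m (a b : 'rV[R]_(1 + m)) (p : R -> R) (q : 'rV[R]_m -> R) :
  continuous p -> continuous q ->
  box_integral a b (fun u : 'rV[R]_(1 + m) => p (u 0 0) * q (rsubmx u)) =
  (\int[mu]_(t in `[a 0 0, b 0 0]) p t)%R * box_integral (rsubmx a) (rsubmx b) q.
Proof.
move=> cp cq /=; rewrite -RintegralZr //; last first.
  by apply: integrable_itv_continuous => t _; exact: cp.
congr fine; apply: eq_integral => t _; congr _%:E.
rewrite -box_integralZl //; congr box_integral; apply/funext => u.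
rewrite row_mxKr; congr (p _ * _).
have -> : 0 = lshift m (0 : 'I_1) by exact: val_inj.
by rewrite row_mxEl mxE eqxx mulr1n.
Qed.

Lemma box_integral_bound m (a b : 'rV[R]_m) (f : 'rV[R]_m -> R) M :
  (forall j, a 0 j <= b 0 j) -> continuous f -> (forall u, `|f u| <= M) ->
  `|box_integral a b f| <= M * \prod_(j < m) (b 0 j - a 0 j).
Proof.
elim: m a b f => [|m IH] a b f ab cf fM; first by rewrite big_ord0 mulr1 /=; exact: fM.
have e0 : ord0 = lshift m (0 : 'I_1) by exact: val_inj.
have eS (j : 'I_m) : lift ord0 j = rshift 1 j by exact: val_inj.
rewrite -[m.+1]/(1 + m)%N in a b f ab cf fM e0 eS *.
rewrite big_ord_recl /=; pose V := \prod_(j < m) (rsubmx b 0 j - rsubmx a 0 j).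
have -> : \prod_(i < m) (b 0 (lift ord0 i) - a 0 (lift ord0 i)) = V.
  by apply: eq_bigr => j _; rewrite !mxE eS.
rewrite (le_trans (le_normr_Rintegral _ _)) //; first exact: integrable_slices.
apply: (@le_trans _ _ (\int[mu]_(t in `[a 0 0, b 0 0]) (M * V))%R).
  apply: le_Rintegral => //.
  - have := integrable_slices a b cf (a 0 0) (b 0 0).
    by move=> /integrable_norm.
  - by apply: integrable_itv_continuous => t _; exact: cvg_cst.
  - move=> t _; apply: IH => //.
    + by move=> j; rewrite !mxE.
    + exact: continuous_slice.
by rewrite (Rintegral_itv_cst _ (ab 0)) -mulrA [V * _]mulrC.
Qed.

End BoxIntegral.

(** * The area element in spherical coordinates *)

Section RowVectors.
Context {R : realType}.

Lemma row_mx_ord0 m (t : R) (u : 'rV[R]_m) :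
  (row_mx (t%:M : 'rV[R]_1) u : 'rV[R]_(1 + m)) 0 ord0 = t.
Proof.
have -> : ord0 = lshift m (0 : 'I_1) by exact: val_inj.
by rewrite row_mxEl mxE eqxx mulr1n.
Qed.

Lemma row_mx_lift m (t : R) (u : 'rV[R]_m) (j : 'I_m) :
  (row_mx (t%:M : 'rV[R]_1) u : 'rV[R]_(1 + m)) 0 (lift ord0 j) = u 0 j.
Proof.
have -> : lift ord0 j = rshift 1 j by exact: val_inj.
by rewrite row_mxEr.
Qed.

Lemma row_mx_eta m (v : 'rV[R]_(1 + m)) :
  v = row_mx ((v 0 0)%:M : 'rV[R]_1) (rsubmx v).
Proof.
rewrite -[LHS]hsubmxK; congr row_mx; rewrite [LHS]mx11_scalar mxE.
by congr ((v _ _)%:M); exact: val_inj.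
Qed.

Lemma differentiable_rV (V : normedModType R) n (g : V -> 'rV[R]_n) x :
  (forall j, differentiable (fun v => g v 0 j) x) -> differentiable g x.
Proof.
move=> dg; have -> : g = \sum_(j < n) (fun v => g v 0 j *: delta_mx 0 j).
  apply/funext => v; rewrite [LHS]row_sum_delta fct_sumE.
  by apply: eq_bigr => j _.
by apply: differentiable_sum => j; exact: differentiableZl.
Qed.

Lemma differentiable_prod (V : normedModType R) (I : Type) (r : seq I) (P : pred I)
    (f : I -> V -> R) x :
  (forall i, differentiable (f i) x) ->
  differentiable (fun v => \prod_(i <- r | P i) f i v) x.
Proof.
move=> df; elim: r => [|i r IH].
  by under eq_fun do rewrite big_nil; exact: differentiable_cst.
under eq_fun do rewrite big_cons; case: (P i) => //.
exact: differentiableM.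
Qed.

End RowVectors.

Section SphericalCoordinates.
Context {R : realType}.

Notation X m := (@sphere_param R m.+1).

Lemma differentiable_sphere_param n (u : 'rV[R]_n.-1) :
  differentiable (@sphere_param R n) u.
Proof.
apply: differentiable_rV => j; under eq_fun do rewrite mxE.
have dc (f : R -> R) k : (forall x, derivable f x 1) ->
    differentiable (fun v : 'rV[R]_n.-1 => f (v 0 k)) u.
  move=> df; apply: (differentiable_comp (f := fun v : 'rV[R]_n.-1 => v 0 k)).
    exact: differentiable_coord.
  exact/derivable1_diffP.
apply: differentiableM; apply: differentiable_prod => k; apply: dc => x; exact: ex_derive.
Qed.

Lemma sphere_param0 (u : 'rV[R]_0) : X 0 u = 1%:M.
Proof.
apply/rowP => j; rewrite !mxE !big_ord0 mulr1.
by case: j => -[].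
Qed.

(** The recursion behind every induction below. It starts from the constant point 1 of the line, and
    the circle arises from its first step. *)
Lemma sphere_paramS m (t : R) (u : 'rV[R]_m) :
  X m.+1 (row_mx (t%:M : 'rV[R]_1) u) =
  row_mx ((cos t)%:M : 'rV[R]_1) (sin t *: X m u) :> 'rV[R]_(1 + m.+1).
Proof.
apply/rowP => j; rewrite mxE /=; case: (unliftP ord0 j) => [k|] ->; last first.
  rewrite row_mx_ord0 big_pred0 // mul1r big_mkcond big_ord_recl /= row_mx_ord0.
  by rewrite big1 ?mulr1.
rewrite row_mx_lift !mxE mulrA; congr (_ * _).
  rewrite big_mkcond big_ord_recl /= row_mx_ord0 [in RHS]big_mkcond; congr (_ * _).
  apply: eq_bigr => i _; rewrite row_mx_lift.
  by rewrite /bump /= !add1n ltnS.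
rewrite big_mkcond big_ord_recl /= mul1r [in RHS]big_mkcond.
by apply: eq_bigr => i _; rewrite row_mx_lift /bump /= !add1n eqSS.
Qed.

Lemma derive_sphere_param_ord0 m (t : R) (u : 'rV[R]_m) :
  'D_(row_mx (1%:M : 'rV[R]_1) 0) (X m.+1) (row_mx (t%:M : 'rV[R]_1) u) =
  row_mx ((- sin t)%:M : 'rV[R]_1) (cos t *: X m u) :> 'rV[R]_(1 + m.+1).
Proof.
apply: (cvg_lim (@norm_hausdorff _ _)).
have -> : (fun h : R => h^-1 *: (X m.+1 (h *: row_mx (1%:M : 'rV[R]_1) (0 : 'rV[R]_m) +
      row_mx (t%:M : 'rV[R]_1) u) - X m.+1 (row_mx (t%:M : 'rV[R]_1) u))) =
  (fun h : R => row_mx ((h^-1 *: (cos (h *: 1 + t) - cos t))%:M : 'rV[R]_1)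
    ((h^-1 *: (sin (h *: 1 + t) - sin t)) *: X m u) : 'rV[R]_(1 + m.+1)).
  apply/funext => h.
  have -> : h *: row_mx (1%:M : 'rV[R]_1) (0 : 'rV[R]_m) + row_mx (t%:M : 'rV[R]_1) u =
      row_mx ((h *: 1 + t)%:M : 'rV[R]_1) u.
    by rewrite scale_row_mx add_row_mx scaler0 add0r scale_scalar_mx -raddfD.
  rewrite !sphere_paramS (@opp_row_mx _ 1 1 m.+1) (@add_row_mx _ 1 1 m.+1).
  by rewrite (@scale_row_mx _ 1 1 m.+1) -raddfB scale_scalar_mx -scalerBl scalerA.
have dcos : h^-1 *: (cos (h *: 1 + t) - cos t) @[h --> 0^'] --> - sin t.
  by have [d <-] := is_derive_cos t.
have dsin : h^-1 *: (sin (h *: 1 + t) - sin t) @[h --> 0^'] --> cos t.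
  by have [d <-] := is_derive_sin t.
apply: cvg_rV => j; case: (unliftP ord0 j) => [k|] ->.
  rewrite row_mx_lift; under eq_fun do rewrite row_mx_lift mxE.
  by rewrite mxE; apply: cvgM => //; exact: cvg_cst.
by rewrite row_mx_ord0; under eq_fun do rewrite row_mx_ord0.
Qed.

Lemma derive_sphere_param_lift m (t : R) (u w : 'rV[R]_m) :
  'D_(row_mx (0 : 'rV[R]_1) w) (X m.+1) (row_mx (t%:M : 'rV[R]_1) u) =
  row_mx (0 : 'rV[R]_1) (sin t *: 'D_w (X m) u) :> 'rV[R]_(1 + m.+1).
Proof.
apply: (cvg_lim (@norm_hausdorff _ _)).
pose q h := h^-1 *: (X m (h *: w + u) - X m u).
have -> : (fun h : R => h^-1 *: (X m.+1 (h *: row_mx (0 : 'rV[R]_1) w +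
      row_mx (t%:M : 'rV[R]_1) u) - X m.+1 (row_mx (t%:M : 'rV[R]_1) u))) =
  (fun h : R => row_mx (0%:M : 'rV[R]_1) (sin t *: q h) : 'rV[R]_(1 + m.+1)).
  apply/funext => h.
  rewrite scale_row_mx add_row_mx scaler0 add0r !sphere_paramS.
  rewrite (@opp_row_mx _ 1 1 m.+1) (@add_row_mx _ 1 1 m.+1) (@scale_row_mx _ 1 1 m.+1).
  by rewrite subrr scaler0 raddf0 -scalerBr /q !scalerA [_ * sin t]mulrC.
have dq : q h @[h --> 0^'] --> 'D_w (X m) u.
  have : derivable (X m) u w by apply: diff_derivable; exact: differentiable_sphere_param.
  exact.
have <- : 0%:M = 0 :> 'rV[R]_1 by rewrite raddf0.
apply: cvg_rV => j; case: (unliftP ord0 j) => [k|] ->.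
  rewrite row_mx_lift; under eq_fun do rewrite row_mx_lift mxE.
  rewrite mxE; apply: cvgM; first exact: cvg_cst.
  exact: (cvg_comp q (fun v : 'rV[R]_m.+1 => v 0 k) dq (@continuous_coord R _ k _)).
by rewrite row_mx_ord0; under eq_fun do rewrite row_mx_ord0; exact: cvg_cst.
Qed.

(** Each row is the derivative along a basis vector: the first angle moves both blocks, the others
    only the lower-dimensional point. *)
Lemma jacobian_sphere_param m (t : R) (u : 'rV[R]_m) :
  'J (X m.+1) (row_mx (t%:M : 'rV[R]_1) u) =
  block_mx ((- sin t)%:M : 'rV[R]_1) (cos t *: X m u) 0 (sin t *: 'J (X m) u)
  :> 'M[R]_(1 + m, 1 + m.+1).
Proof.
apply/row_matrixP => i; rewrite !rowE.
rewrite -deriveEjacobian; last exact: (@differentiable_sphere_param m.+2).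
rewrite -[block_mx _ _ _ _]/(col_mx _ _).
case: (split_ordP i) => [k|k] ->.
  rewrite ord1 delta_mx_lshift mul_row_col mul0mx addr0.
  have -> : delta_mx 0 0 = 1%:M :> 'rV[R]_1.
    by apply/matrixP => a b; rewrite !ord1 !mxE.
  by rewrite mul1mx derive_sphere_param_ord0.
rewrite delta_mx_rshift mul_row_col mul0mx add0r mul_mx_row mulmx0 -scalemxAr.
rewrite -deriveEjacobian; last exact: (@differentiable_sphere_param m.+1).
exact: derive_sphere_param_lift.
Qed.

Lemma sphere_param_norm m (u : 'rV[R]_m) : X m u *m (X m u)^T = 1%:M.
Proof.
elim: m u => [|m IH] u; first by rewrite sphere_param0 trmx1 mulmx1.
rewrite (@row_mx_eta _ m u) sphere_paramS (@tr_row_mx _ 1 1 m.+1).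
rewrite (@mul_row_col _ 1 1 m.+1) tr_scalar_mx.
rewrite -scalar_mxM linearZ /= -scalemxAl -scalemxAr IH scalerA.
by rewrite scale_scalar_mx mulr1 -raddfD /= -!expr2 cos2Dsin2.
Qed.

(** The partial derivatives are tangent to the sphere; this kills the cross terms of the Gram matrix
    in [area_elementS]. *)
Lemma sphere_param_orthogonal m (u : 'rV[R]_m) : X m u *m ('J (X m) u)^T = 0.
Proof.
elim: m u => [|m IH] u; first by apply/matrixP => i [].
rewrite (@row_mx_eta _ m u) sphere_paramS jacobian_sphere_param.
rewrite (@tr_block_mx _ 1 m 1 m.+1) trmx0 (@mul_row_block _ 1 1 m.+1 1 m) mulmx0 add0r tr_scalar_mx.
rewrite -scalar_mxM !linearZ /= -!scalemxAl IH !scaler0 sphere_param_norm.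
rewrite !scale_scalar_mx mulr1 -raddfD /=.
have -> : cos (u 0 0) * - sin (u 0 0) + cos (u 0 0) * sin (u 0 0) = 0 by ring.
by rewrite raddf0 row_mx0.
Qed.

Lemma area_element0 (u : 'rV[R]_0) : area_element (X 0) u = 1.
Proof. by rewrite /area_element det_mx00 sqrtr1. Qed.

(** The Gram matrix is block diagonal with corner sin^2 t + cos^2 t = 1 and lower block sin^2 t
    times the Gram matrix of size m. Its determinant gains sin^(2m) t, and the square root yields an
    absolute value. *)
Lemma area_elementS m (t : R) (u : 'rV[R]_m) :
  area_element (X m.+1) (row_mx (t%:M : 'rV[R]_1) u) =
  `|sin t| ^+ m * area_element (X m) u.
Proof.
rewrite /area_element jacobian_sphere_param (@tr_block_mx _ 1 m 1 m.+1) trmx0.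
rewrite (@mulmx_block _ 1 m 1 m.+1 1 m).
rewrite !mul0mx !mulmx0 !add0r tr_scalar_mx -scalar_mxM !linearZ /=.
rewrite -!scalemxAl sphere_param_norm.
have h : 'J (X m) u *m (X m u)^T = 0.
  by rewrite -[LHS]trmxK trmx_mul trmxK sphere_param_orthogonal trmx0.
rewrite h sphere_param_orthogonal !scaler0 !scalerA scale_scalar_mx mulr1 -raddfD /=.
have -> : - sin t * - sin t + cos t * cos t = 1 by rewrite -[RHS](cos2Dsin2 t); ring.
rewrite (@det_ublock _ 1 m) det1 mul1r detZ sqrtrM; last by rewrite exprn_ge0 // -expr2 sqr_ge0.
by rewrite -expr2 -exprM mulnC exprM sqrtr_sqr normrX.
Qed.

Lemma area_element_sphere_ge0 m (u : 'rV[R]_m) : 0 <= area_element (X m) u.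
Proof. exact: sqrtr_ge0. Qed.

Lemma area_element_sphere_le1 m (u : 'rV[R]_m) : area_element (X m) u <= 1.
Proof.
elim: m u => [|m IH] u; first by rewrite area_element0.
rewrite (@row_mx_eta _ m u) area_elementS mulr_ile1 ?exprn_ge0 ?area_element_sphere_ge0 //.
by rewrite exprn_ile1 // ler_norml sin_geN1 sin_le1.
Qed.

Lemma continuous_area_element_sphere m : continuous (area_element (X m)).
Proof.
elim: m => [|m IH].
  have -> : area_element (X 0) = cst 1 by apply/funext => u; exact: area_element0.
  exact: cst_continuous.
have -> : area_element (X m.+1) =
    (fun v : 'rV[R]_(1 + m) => `|sin (v 0 0)| ^+ m * area_element (X m) (rsubmx v)).
  by apply/funext => v; rewrite {1}(@row_mx_eta _ m v) area_elementS.
have c2 : continuous (fun v : 'rV[R]_(1 + m) => area_element (X m) (rsubmx v)).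
  move=> v; apply: (continuous_comp (f := rsubmx) (g := area_element (X m))); last exact: IH.
  by apply: differentiable_continuous; exact: differentiable_rsubmx.
have cabs : continuous (fun x : R => `|x| ^+ m).
  move=> x; apply: (continuous_comp (f := fun x : R => `|x|) (g := fun x : R => x ^+ m)).
    exact: norm_continuous.
  exact: exprn_continuous.
have csin : continuous (fun v : 'rV[R]_(1 + m) => sin (v 0 0)).
  move=> v; apply: (continuous_comp (f := fun v : 'rV[R]_(1 + m) => v 0 0) (g := sin)).
    exact: continuous_coord.
  exact: continuous_sin.
have c1 : continuous (fun v : 'rV[R]_(1 + m) => `|sin (v 0 0)| ^+ m).
  move=> v; apply: (continuous_comp (f := fun v : 'rV[R]_(1 + m) => sin (v 0 0))
    (g := fun x : R => `|x| ^+ m)); [exact: csin|exact: cabs].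
by move=> v; exact: (cvgM (c1 v) (c2 v)).
Qed.

Lemma continuous_sphere_param m : continuous (X m).
Proof.
by move=> u; apply: differentiable_continuous; exact: (@differentiable_sphere_param m.+1).
Qed.

Lemma sphere_param_le1 m (u : 'rV[R]_m) j : `|X m u 0 j| <= 1.
Proof.
have := sphere_param_norm u => /matrixP /(_ 0 0).
rewrite [LHS]mxE [RHS]mxE eqxx mulr1n.
under eq_bigr do rewrite [Y in _ * Y]mxE -expr2.
move=> h; rewrite -(@expr_le1 _ 2) // real_normK ?num_real // -h (bigD1 j) //= lerDl.
by apply: sumr_ge0 => k _; exact: sqr_ge0.
Qed.

End SphericalCoordinates.

(** * Moments of the sphere *)

Section SphereIntegral.
Context {R : realType}.
Notation mu := (@lebesgue_measure R).
Notation X m := (@sphere_param R m.+1).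

Lemma continuous_sumr (T : topologicalType) (I : Type) (r : seq I) (F : I -> T -> R) :
  (forall i, continuous (F i)) -> continuous (fun x => \sum_(i <- r) F i x).
Proof.
move=> cF; elim: r => [|k r IH].
  by under eq_fun do rewrite big_nil; exact: cst_continuous.
under eq_fun do rewrite big_cons.
by move=> x; exact: (cvgD (cF k x) (IH x)).
Qed.

Lemma continuous_monomial n (alpha : 'I_n -> nat) :
  continuous (monomial alpha : 'rV[R]_n -> R).
Proof.
move=> x; apply: differentiable_continuous; apply: differentiable_prod => j.
elim: (alpha j) => [|k IH].
  by under eq_fun do rewrite expr0; exact: differentiable_cst.
under eq_fun do rewrite exprS.
by apply: differentiableM => //; exact: differentiable_coord.
Qed.

Section Linearity.
Variables (m : nat) (f g : 'rV[R]_m.+1 -> R).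
Hypotheses (cf : continuous f) (cg : continuous g).

Let continuous_integrand (h : 'rV[R]_m.+1 -> R) : continuous h ->
  continuous (fun u : 'rV[R]_m => h (X m u) * area_element (X m) u).
Proof.
move=> ch u; apply: (cvgM _ (@continuous_area_element_sphere R m u)).
exact: (continuous_comp (@continuous_sphere_param R m u) (ch _)).
Qed.

Lemma sphere_integralD :
  sphere_integral (fun x => f x + g x) = sphere_integral f + sphere_integral g.
Proof.
rewrite /sphere_integral /surface_integral -box_integralD; try exact: continuous_integrand.
by congr box_integral; apply/funext => u; rewrite mulrDl.
Qed.

Lemma sphere_integralZl k :
  sphere_integral (fun x => k * f x) = k * sphere_integral f.
Proof.
rewrite /sphere_integral /surface_integral -box_integralZl; last exact: continuous_integrand.
by congr box_integral; apply/funext => u; rewrite mulrA.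
Qed.

(** The volume of the box of angles. It bounds the surface area, since the area element is at most
    1. *)
Definition sphere_box_volume : R := \prod_(j < m) sphere_angle_max m.+1 0 j.

Lemma sphere_angle_max_ge0 j : 0 <= sphere_angle_max (R := R) m.+1 0 j.
Proof. by rewrite mxE; case: ifP; rewrite ?mulr_ge0 ?pi_ge0. Qed.

(** The bound on f is asked on the cube around the sphere, where coordinatewise estimates of
    monomials and scalar products suffice. *)
Lemma sphere_integral_bound M :
  (forall x : 'rV[R]_m.+1, (forall j, `|x 0 j| <= 1) -> `|f x| <= M) ->
  `|sphere_integral f| <= M * sphere_box_volume.
Proof.
move=> fM; rewrite /sphere_integral /surface_integral.
apply: le_trans (@box_integral_bound R m 0 (sphere_angle_max m.+1) _ M _ _ _) _.
- by move=> j; rewrite mxE sphere_angle_max_ge0.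
- exact: continuous_integrand.
- move=> u; rewrite normrM [`|area_element _ _|]ger0_norm ?area_element_sphere_ge0 //.
  rewrite (le_trans (ler_piMr _ (area_element_sphere_le1 _))) //.
  by apply: fM => j; exact: sphere_param_le1.
- by under eq_bigr do rewrite [Y in _ - Y]mxE subr0.
Qed.

End Linearity.

Lemma sphere_integral_sum m (I : Type) (r : seq I) (F : I -> 'rV[R]_m.+1 -> R) :
  (forall i, continuous (F i)) ->
  sphere_integral (fun x => \sum_(i <- r) F i x) = \sum_(i <- r) sphere_integral (F i).
Proof.
move=> cF; elim: r => [|i r IH].
  rewrite big_nil -[RHS](mul0r (sphere_integral (cst 1 : 'rV[R]_m.+1 -> R))).
  rewrite -sphere_integralZl; last exact: cst_continuous.
  by congr sphere_integral; apply/funext => x; rewrite big_nil mul0r.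
rewrite big_cons -IH -sphere_integralD //; last exact: continuous_sumr.
by congr sphere_integral; apply/funext => x; rewrite big_cons.
Qed.

Lemma monomial_row_mx m (alpha : 'I_m.+1 -> nat) (c s : R) (y : 'rV[R]_m) :
  monomial alpha (row_mx (c%:M : 'rV[R]_1) (s *: y)) =
  c ^+ alpha ord0 * s ^+ (\sum_j alpha (lift ord0 j))%N *
  monomial (fun j => alpha (lift ord0 j)) y.
Proof.
rewrite /monomial big_ord_recl row_mx_ord0 -mulrA; congr (_ * _).
rewrite -prodrXr -big_split /=; apply: eq_bigr => j _.
by rewrite row_mx_lift mxE exprMn.
Qed.

Lemma sphere_moment_step m (alpha : 'I_m.+2 -> nat) :
  sphere_integral (monomial alpha : 'rV[R]_m.+2 -> R) =
  (\int[mu]_(t in `[0%R, sphere_angle_max m.+2 0 0])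
    (cos t ^+ alpha ord0 * sin t ^+ (\sum_j alpha (lift ord0 j))%N * `|sin t| ^+ m))%R *
  box_integral (rsubmx (0 : 'rV[R]_(1 + m)))
    (rsubmx (sphere_angle_max m.+2 : 'rV[R]_(1 + m)))
    (fun u => monomial (fun j => alpha (lift ord0 j)) (X m u) * area_element (X m) u).
Proof.
rewrite /sphere_integral /surface_integral.
pose p (t : R) := cos t ^+ alpha ord0 * sin t ^+ (\sum_j alpha (lift ord0 j))%N * `|sin t| ^+ m.
pose q (u : 'rV[R]_m) := monomial (fun j => alpha (lift ord0 j)) (X m u) * area_element (X m) u.
have -> : (fun u => monomial alpha (X m.+1 u) * area_element (X m.+1) u) =
    (fun u : 'rV[R]_(1 + m) => p (u 0 0) * q (rsubmx u)).
  apply/funext => u; rewrite {1 2}(@row_mx_eta _ m u) sphere_paramS area_elementS.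
  by rewrite monomial_row_mx /p /q; ring.
rewrite (@box_integral_prod R m) ?mxE //.
- move=> t; apply: cvgM; first exact: continuous_trig_monomial.
  apply: (continuous_comp (f := fun t : R => `|sin t|) (g := fun x : R => x ^+ m)).
    by apply: (continuous_comp (f := sin)); [exact: continuous_sin|exact: norm_continuous].
  exact: exprn_continuous.
- move=> u; apply: (cvgM _ (@continuous_area_element_sphere R m u)).
  exact: (continuous_comp (@continuous_sphere_param R m u) (@continuous_monomial _ _ _)).
Qed.

(** The Beta values telescope: the numerator Gamma((m + 2 + s)/2) of the new angle cancels the
    denominator of the moment one dimension lower. *)
Lemma sphere_moment m (alpha : 'I_m.+2 -> nat) :
  sphere_integral (monomial alpha : 'rV[R]_m.+2 -> R) =
  2 * Num.sqrt pi ^+ m.+2 * (\prod_j even_doublefact (alpha j)) *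
  Num.sqrt 2 ^- mlength alpha / half_Gamma (m.+2 + mlength alpha).
Proof.
elim: m alpha => [|m IH] alpha; rewrite sphere_moment_step.
  rewrite /= sphere_param0 area_element0 mulr1.
  have -> : monomial (fun j => alpha (lift ord0 j)) (1%:M : 'rV[R]_1) = 1.
    by rewrite /monomial big1 // => j _; rewrite mxE !ord1 eqxx expr1n.
  rewrite mulr1.
  transitivity (trig_integral (R := R) (2 * pi)
    (alpha ord0) (alpha (lift ord0 ord0))).
    (* For the circle |sin t| has exponent 0, so the sign changes of the sine over the full turn do
       no harm. All further angles stay in [0, pi]. *)
    rewrite /trig_integral mxE /=; congr fine; apply: eq_integral => t _.
    by rewrite expr0 mulr1 big_ord_recl big_ord0 addn0.
  rewrite trig_integral_2pi /mlength !big_ord_recl !big_ord0 addn0 mulr1.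
  rewrite sqr_sqrtr ?pi_ge0 // add2n; ring.
pose s := (\sum_j alpha (lift ord0 j))%N.
have es : mlength alpha = (alpha ord0 + s)%N by rewrite /mlength big_ord_recl.
have -> : rsubmx (0 : 'rV[R]_(1 + m.+1)) = 0 by apply/rowP => j; rewrite !mxE.
have -> : rsubmx (sphere_angle_max m.+3 : 'rV[R]_(1 + m.+1)) = sphere_angle_max m.+2.
  by apply/rowP => j; rewrite !mxE.
rewrite -[box_integral _ _ _]/(sphere_integral (monomial (fun j => alpha (lift ord0 j)))) IH.
have -> : mlength (fun j => alpha (lift ord0 j)) = s by [].
transitivity (trig_integral (R := R) pi (alpha ord0) (s + m.+1) *
  (2 * Num.sqrt pi ^+ m.+2 * (\prod_j even_doublefact (alpha (lift ord0 j))) *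
  Num.sqrt 2 ^- s / half_Gamma (m.+2 + s))).
  congr (_ * _); rewrite /trig_integral mxE /=; congr fine; apply: eq_integral => t.
  rewrite inE /= in_itv /= => /andP[t0 tpi].
  by rewrite exprD mulrA ger0_norm // sin_ge0_pi // t0.
rewrite trig_integral_pi [\prod_j even_doublefact (alpha j)]big_ord_recl es exprD.
have -> : (s + m.+1).+1 = (m.+2 + s)%N by lia.
have -> : (alpha ord0 + (s + m.+1)).+2 = (m.+3 + (alpha ord0 + s))%N by lia.
have n1 : half_Gamma (m.+2 + s) != 0 :> R by rewrite gt_eqF // half_Gamma_gt0.
have n2 : half_Gamma (m.+3 + (alpha ord0 + s)) != 0 :> R by rewrite gt_eqF // half_Gamma_gt0.
rewrite [Num.sqrt pi ^+ m.+3]exprS.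
move: (half_Gamma _) (half_Gamma _) n1 n2 => g1 g2 n1 n2.
by field; rewrite n1 n2 !expf_neq0 // gt_eqF // sqrtr_gt0.
Qed.

End SphereIntegral.

(** * Behaviour at the origin *)

Section TaylorBounds.
Context {R : realType}.
Implicit Types x : R.

(** Recording only |c| <= |x| treats both signs of x at once, and lets each bound below follow from
    the preceding order. *)
Lemma MVT0 (f df : R -> R) x : (forall y, is_derive y (1 : R) f (df y)) ->
  exists2 c, `|c| <= `|x| & f x - f 0 = df c * x.
Proof.
move=> dfE; have cf A : {within A, continuous f}.
  apply: continuous_subspaceT => y; apply: differentiable_continuous.
  by apply/derivable1_diffP; case: (dfE y).
have [x0|x0] := leP 0 x.
  have [c] := MVT_segment x0 (fun y _ => dfE y) (cf _).
  rewrite in_itv /= => /andP[c0 cx]; rewrite subr0 => e; exists c => //.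
  by rewrite !ger0_norm.
have [c] := MVT_segment (ltW x0) (fun y _ => dfE y) (cf _).
rewrite in_itv /= => /andP[xc c0] e; exists c.
  by rewrite !ler0_norm ?(ltW x0) // lerN2.
by rewrite -[LHS]opprB e; ring.
Qed.

Lemma norm_sin_le x : `|sin x| <= `|x|.
Proof.
have [c _] := MVT0 x (@is_derive_sin R).
by rewrite sin0 subr0 => ->; rewrite normrM ler_piMl // cos_max.
Qed.

Lemma norm_cosB1_le x : `|cos x - 1| <= `|x|.
Proof.
have [c _] := MVT0 x (@is_derive_cos R).
by rewrite cos0 => ->; rewrite normrM normrN ler_piMl // sin_max.
Qed.

(** Only the order matters for this bound and the next: one application of the mean value theorem to
    a linear bound gives a quadratic one, with constant 1. *)
Lemma norm_cosB1_sqr x : `|cos x - 1| <= x ^+ 2.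
Proof.
have [c cx] := MVT0 x (@is_derive_cos R).
rewrite cos0 => ->; rewrite normrM normrN -(real_normK (num_real x)) expr2.
by rewrite ler_wpM2r // (le_trans (norm_sin_le c)).
Qed.

Lemma norm_sinB_sqr x : `|x - sin x| <= x ^+ 2.
Proof.
have dE y : is_derive y (1 : R) (fun x => x - sin x) (1 - cos y) by exact: is_derive_eq.
have [c cx] := MVT0 x dE.
rewrite sin0 !subr0 => ->; rewrite normrM -(real_normK (num_real x)) expr2.
by rewrite ler_wpM2r // distrC (le_trans (norm_cosB1_le c)).
Qed.

(** From 1 - x <= e^(-x), multiplied by e^x. *)
Lemma expRB1_le x : 0 <= x <= 1 -> expR x - 1 <= expR 1 * x.
Proof.
move=> /andP[x0 x1]; apply: (@le_trans _ _ (expR x * x)); last first.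
  by rewrite ler_wpM2r // ler_expR.
rewrite lerBlDr -lerBlDl -{1}[expR x]mulr1 -mulrBr.
by rewrite -ler_pdivlMl ?expR_gt0 // mulr1 -expRN expR_ge1Dx.
Qed.

End TaylorBounds.

(** * Variation of the Bessel factor near the origin *)

Section BesselNearZero.
Context {R : realType}.

(** Each unit shift multiplies by a factor s + k >= 1. *)
Lemma Gamma_le_addn (s : R) k : 1 <= s -> 0 < Gamma s -> Gamma s <= Gamma (s + k%:R).
Proof.
move=> s1 g0; elim: k => [|k IH]; first by rewrite addr0.
rewrite -natr1 addrA GammaS; last by rewrite ltr_wpDr // (lt_le_trans ltr01).
rewrite (le_trans IH) // ler_peMl ?(le_trans _ IH) ?(ltW g0) //.
by rewrite (le_trans s1) // lerDl.
Qed.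

(** With y = (|xi|/2)^2 the terms of positive index sum to at most D (e^y - 1) <= D e y, and y <=
    |xi|^2; hence the factor [expR 1]. *)
Lemma Psi_near0 n (nu : R) (xi : 'rV[R]_n) : 0 <= nu -> 0 < Gamma (nu + 1) ->
  enorm xi <= 1 ->
  `|Psi nu xi - Psi nu (0 : 'rV[R]_n)| <=
    2 `^ (- nu) * (Gamma (nu + 1))^-1 * expR 1 * enorm xi ^+ 2.
Proof.
move=> nu0 g0 r1; set r := enorm xi in r1 *.
have r0 : 0 <= r by exact: sqrtr_ge0.
rewrite [Psi nu 0]/Psi eqxx Psi_series -/r; set D := (Gamma (nu + 1))^-1.
have D0 : 0 <= D by rewrite invr_ge0 ltW.
set v := fun k : nat => _ / (_ * _) * (r / 2) ^+ _.
pose y := (r / 2) ^+ 2.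
have y0 : 0 <= y by exact: sqr_ge0.
have yr : y <= r ^+ 2 by rewrite /y expr_div_n ler_pdivrMr //; nra.
have y1 : y <= 1 by rewrite (le_trans yr) // exprn_ile1.
have v0 : v 0 = D.
  by rewrite /v muln0 !expr0 fact0 addr0 !mul1r mulr1.
(* Gamma (nu + k + 1) >= Gamma (nu + 1), so the series of exp y dominates. *)
have vle k : `|v k| <= D * exp_coeff y k.
  have -> : v k = (-1) ^+ k * ((Gamma (nu + k%:R + 1))^-1 * exp_coeff y k).
    by rewrite /v exprM /exp_coeff /= invfM; ring.
  have gk : Gamma (nu + 1) <= Gamma (nu + k%:R + 1).
    by rewrite addrAC Gamma_le_addn // lerDr.
  rewrite normrM normrX normrN1 expr1n mul1r normrM [`|exp_coeff _ _|]ger0_norm ?exp_coeff_ge0 //.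
  apply: ler_wpM2r; first exact: exp_coeff_ge0.
  rewrite ger0_norm; last by rewrite invr_ge0 (le_trans _ gk) // ltW.
  rewrite lef_pV2; [exact: gk| |exact: g0].
  by rewrite posrE (lt_le_trans g0 gk).
have cv : cvgn (series v).
  apply: normed_cvg; apply: (@series_le_cvg _ _ (fun k => D * exp_coeff y k)) => //.
  - by move=> k; exact: normr_ge0.
  - by move=> k; rewrite mulr_ge0 ?exp_coeff_ge0.
  - exact: is_cvg_seriesZ (is_cvg_series_exp_coeff y).
have partial k : `|series v k.+1 - D| <= D * (expR y - 1).
  rewrite -v0 seriesEnat /= big_nat_recl // addrAC subrr add0r v0.
  rewrite (le_trans (ler_norm_sum _ _ _)) //.
  rewrite (le_trans (ler_sum _ (fun i _ => vle i.+1))) // -mulr_sumr ler_wpM2l //.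
  rewrite lerBrDl; have e0 : exp_coeff y 0 = 1 by rewrite /exp_coeff /= expr0 fact0 divr1.
  rewrite -{1}e0 -(@big_nat_recl _ _ _ _ _ (exp_coeff y)) //.
  have := @nondecreasing_cvgn_le _ (series (exp_coeff y)) _ (is_cvg_series_exp_coeff y) k.+1.
  rewrite seriesEnat; apply; apply/nondecreasing_seqP => m.
  by rewrite /= big_nat_recr //= lerDl exp_coeff_ge0.
have lim_le : `|limn (series v) - D| <= D * (expR y - 1).
  have cvn : `|series v k - D| @[k --> \oo] --> `|limn (series v) - D|.
    by apply: cvg_norm; apply: cvgB => //; exact: cvg_cst.
  rewrite -(cvg_lim (@Rhausdorff R) cvn); apply: limr_le.
    by apply/cvg_ex; eexists; exact: cvn.
  (* The partial sum of index 0 is empty and lacks the constant term [D], so the bound holds from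
     index 1 on. *)
  by exists 1%N => // -[//|k] _ /=; exact: partial.
rewrite -mulrBr normrM ger0_norm ?powR_ge0 // -!mulrA ler_wpM2l ?powR_ge0 //.
rewrite (le_trans lim_le) // ler_wpM2l // (le_trans (expRB1_le _)) ?y0 //.
by rewrite ler_wpM2l ?expR_ge0.
Qed.

End BesselNearZero.

Section Normc.
Context {R : realType}.
Notation normc := ComplexField.Normc.normc.

Lemma normc_ge0 (z : R[i]) : 0 <= normc z.
Proof. by case: z => a b; exact: sqrtr_ge0. Qed.

Lemma normc_le (a b : R) : normc (a +i* b) <= `|a| + `|b|.
Proof.
rewrite -[X in _ <= X]ger0_norm ?addr_ge0 // -sqrtr_sqr ler_wsqrtr //.
by rewrite sqrrD !real_normK ?num_real // addrAC lerDl mulrn_wge0 ?mulr_ge0.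
Qed.

Lemma normc_real (a : R) : normc a%:C = `|a|.
Proof. by rewrite /ComplexField.Normc.normc /= expr0n addr0 sqrtr_sqr. Qed.

Lemma normcNi : normc (- 'i%C : R[i]) = 1.
Proof. by rewrite /ComplexField.Normc.normc /= oppr0 sqrrN expr0n expr1n add0r sqrtr1. Qed.

Lemma normc_prod (I : Type) (r : seq I) (P : pred I) (F : I -> R[i]) :
  normc (\prod_(i <- r | P i) F i) = \prod_(i <- r | P i) normc (F i).
Proof.
by apply: (big_morph _ (@ComplexField.Normc.normcM R) (@ComplexField.Normc.normc1 R)).
Qed.

End Normc.

(** * The coefficient A and the value of Psi at the origin *)

Section Coefficient.
Context {R : realType} {n : nat}.
Implicit Types (alpha : 'I_n -> nat) (xi : 'rV[R]_n).
Notation normc := ComplexField.Normc.normc.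

Lemma coord_le_enorm xi j : `|xi 0 j| <= enorm xi.
Proof.
rewrite -sqrtr_sqr ler_wsqrtr // (bigD1 j) //= lerDl.
by apply: sumr_ge0 => k _; exact: sqr_ge0.
Qed.

(** All double factorials of the coefficient A. At an odd exponent a!! is also the [even_doublefact]
    of a + 1, so the same product appears in the moment whose only odd exponent has been raised. *)
Definition doublefact_weight alpha : R :=
  \prod_j (doublefact (if odd (alpha j) then alpha j else alpha j - 1)%N)%:R.

Lemma mono_odd_neq0 alpha j : (mono_odd alpha j != 0%N) = odd (alpha j).
Proof. by rewrite /mono_odd; case: (alpha j) => // k; case: ifP. Qed.

Lemma mu_mono_odd alpha : mu (mono_odd alpha) = #|[set j | odd (alpha j)]%SET|.
Proof. by apply: eq_card => j; rewrite !inE mono_odd_neq0. Qed.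

Lemma A_coefE alpha xi : A_coef alpha xi =
  ((2 * pi) `^ (n%:R / 2) * doublefact_weight alpha)%:C *
  \prod_(m < n | odd (alpha m)) (- 'i%C * (xi 0 m)%:C).
Proof.
rewrite /A_coef.
(* A zero exponent contributes [doublefact 0] = 1, so the product extends to all indices that are
   not odd. *)
have -> : \prod_(m < n | mono_even alpha m != 0%N) (doublefact (mono_even alpha m - 1))%:R =
    \prod_(m < n | ~~ odd (alpha m)) (doublefact (alpha m - 1))%:R :> R[i].
  rewrite big_mkcond [RHS]big_mkcond; apply: eq_bigr => m _.
  rewrite /mono_even /mono_odd; case: (odd (alpha m)); first by rewrite subnn.
  by rewrite subn0; case: (alpha m).
have -> : \prod_(m < n | mono_odd alpha m != 0%N)
      ((doublefact (mono_odd alpha m))%:R * (- 'i%C * (xi 0 m)%:C)) =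
    (\prod_(m < n | odd (alpha m)) (doublefact (alpha m))%:R) *
    \prod_(m < n | odd (alpha m)) (- 'i%C * (xi 0 m)%:C).
  under eq_bigl do rewrite mono_odd_neq0.
  by rewrite -big_split /=; apply: eq_bigr => m om; rewrite /mono_odd om.
rewrite rmorphM /=; have -> : (doublefact_weight alpha)%:C =
    (\prod_(m < n | odd (alpha m)) (doublefact (alpha m))%:R) *
    \prod_(m < n | ~~ odd (alpha m)) (doublefact (alpha m - 1))%:R :> R[i].
  rewrite /doublefact_weight rmorph_prod /= (bigID (fun j => odd (alpha j))) /=.
  congr (_ * _); apply: eq_bigr => m om.
    by rewrite om rmorph_nat.
  by rewrite (negPf om) rmorph_nat.
by ring.
Qed.

Lemma normc_A_coef_le alpha xi : normc (A_coef alpha xi) <=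
  `|(2 * pi) `^ (n%:R / 2) * doublefact_weight alpha| *
  enorm xi ^+ #|[set j | odd (alpha j)]%SET|.
Proof.
rewrite A_coefE ComplexField.Normc.normcM normc_real ler_wpM2l // normc_prod.
rewrite -prodr_const [X in _ <= X](eq_bigl (fun j => odd (alpha j))); last first.
  by move=> j; rewrite inE.
apply: ler_prod => j _; rewrite ComplexField.Normc.normcM normcNi mul1r normc_real.
by rewrite normr_ge0 coord_le_enorm.
Qed.

Lemma powR_half (a : R) k : 0 <= a -> a `^ (k%:R / 2) = Num.sqrt a ^+ k.
Proof. by move=> a0; rewrite mulrC powRrM powR12_sqrt // powR_mulrn // sqrtr_ge0. Qed.

(** The powers of 2 combine as n/2 - nu = 1 - p/2, which leaves the moment formula without its
    double factorials, for degree p. *)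
Lemma Psi_at0 (nu : R) p : nu = (n%:R + p%:R - 2) / 2 ->
  (2 * pi) `^ (n%:R / 2) * Psi nu (0 : 'rV[R]_n) =
  2 * Num.sqrt pi ^+ n * Num.sqrt 2 ^- p / half_Gamma (n + p).
Proof.
move=> nuE; rewrite /Psi eqxx.
have -> : nu + 1 = (n + p)%:R / 2 by rewrite nuE natrD; field.
have -> : - nu = 1 + - ((n + p)%:R / 2) by rewrite nuE natrD; field.
rewrite powRD; last by rewrite pnatr_eq0 implybT.
rewrite powRr1 // powRN powRM ?pi_ge0 // !powR_half ?pi_ge0 // -/(half_Gamma _).
have s2 : Num.sqrt 2 != 0 :> R by rewrite gt_eqF // sqrtr_gt0.
rewrite exprD invfM; set g := (half_Gamma _)^-1.
by field; rewrite !expf_neq0.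
Qed.

End Coefficient.

(** * Matching the first-order expansion with the value at the origin *)

Section FirstOrder.
Context {R : realType} {m : nat}.
Notation n := m.+2.
Implicit Types (alpha : 'I_n -> nat) (xi : 'rV[R]_n).
Notation normc := ComplexField.Normc.normc.

Notation moment alpha := (sphere_integral (monomial alpha : 'rV[R]_n -> R)).

Definition incr_at alpha j : 'I_n -> nat := fun k => (alpha k + (k == j))%N.

Lemma monomial_incr_at alpha j (x : 'rV[R]_n) :
  monomial (incr_at alpha j) x = monomial alpha x * x 0 j.
Proof.
rewrite /monomial /incr_at; under eq_bigr do rewrite exprD.
rewrite big_split /=; congr (_ * _); rewrite (bigD1 j) //= eqxx expr1 big1 ?mulr1 //.
by move=> k /negPf ->; rewrite expr0.
Qed.

Lemma mlength_incr_at alpha j : mlength (incr_at alpha j) = (mlength alpha).+1.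
Proof.
rewrite /mlength /incr_at big_split /= (bigD1 j) //= [X in (_ + X)%N](bigD1 j) //= eqxx.
by rewrite [X in (_ + (1 + X))%N]big1 ?addn0 ?addn1 // => k /negPf ->.
Qed.

Lemma moment_odd alpha j : odd (alpha j) -> moment alpha = 0.
Proof.
by move=> oj; rewrite sphere_moment (bigD1 j) //= {1}/even_doublefact oj !(mul0r, mulr0).
Qed.

Definition first_order alpha xi : R[i] :=
  moment alpha +i* (- \sum_j xi 0 j * moment (incr_at alpha j)).

Variables (alpha : 'I_n -> nat) (nu : R).
Hypothesis nuE : nu = (n%:R + (mlength alpha)%:R + (mu (mono_odd alpha))%:R - 2) / 2.

Let D := [set j | odd (alpha j)]%SET.

Let A_coef_Psi0 xi : A_coef alpha xi * (Psi nu (0 : 'rV[R]_n))%:C =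
  (2 * Num.sqrt pi ^+ n * Num.sqrt 2 ^- (mlength alpha + #|D|) /
    half_Gamma (n + (mlength alpha + #|D|)) * doublefact_weight alpha)%:C *
  \prod_(j < n | odd (alpha j)) (- 'i%C * (xi 0 j)%:C).
Proof.
rewrite A_coefE -(@Psi_at0 _ _ nu) ?[X in _ = X]rmorphM; last first.
  by rewrite nuE mu_mono_odd natrD addrA.
by rewrite !rmorphM /=; ring.
Qed.

(** The surviving moment has degree |alpha| + #|D|, and the term mu in [nu] puts the same number
    into the Gamma argument of Psi at 0. With a single odd index [j0], only raising the exponent at
    [j0] makes all exponents even. *)
Lemma first_order_eq xi : (#|D| <= 1)%N ->
  first_order alpha xi = A_coef alpha xi * (Psi nu (0 : 'rV[R]_n))%:C.
Proof.
rewrite leq_eqVlt ltnS leqn0 A_coef_Psi0 => /orP[/cards1P[j0 Dj0]|/eqP D0].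
  have oddE j : odd (alpha j) = (j == j0).
    by move/finset.setP: Dj0 => /(_ j); rewrite !inE.
  rewrite Dj0 cards1 (big_pred1 j0) //.
  rewrite /first_order (moment_odd (j := j0)) ?oddE ?eqxx // (bigD1 j0) //= big1; last first.
    move=> j jj0; rewrite (moment_odd (j := j0)) ?mulr0 //.
    by rewrite /incr_at [j0 == j]eq_sym (negPf jj0) addn0 oddE eqxx.
  rewrite addr0 sphere_moment mlength_incr_at addn1.
  have -> : \prod_j even_doublefact (incr_at alpha j0 j) = doublefact_weight alpha :> R.
    apply: eq_bigr => j _; rewrite /even_doublefact /incr_at oddD oddE.
    by case: eqP => _ /=; rewrite ?addn1 ?subn1 ?addn0.
  by apply/eqP; rewrite eq_complex /=; apply/andP; split; apply/eqP; ring.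
have oddF j : odd (alpha j) = false.
  by move/finset.setP: (cards0_eq D0) => /(_ j); rewrite !inE.
rewrite D0 big_pred0 // mulr1 addn0 /first_order big1; last first.
  move=> j _; rewrite (moment_odd (j := j)) ?mulr0 //.
  by rewrite /incr_at eqxx addn1 /= oddF.
rewrite sphere_moment oppr0.
have -> : \prod_j even_doublefact (alpha j) = doublefact_weight alpha :> R.
  by apply: eq_bigr => j _; rewrite /even_doublefact oddF.
by apply/eqP; rewrite eq_complex /=; apply/andP; split; apply/eqP; ring.
Qed.

(** Raising one exponent repairs at most one of two odd exponents. *)
Lemma first_order_eq0 xi : (1 < #|D|)%N -> first_order alpha xi = 0.
Proof.
move=> /card_gt1P[j [k [+ + jk]]]; rewrite !inE => oj ok.
rewrite /first_order (moment_odd oj) big1 ?oppr0 // => l _.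
have [lj|lj] := eqVneq l j.
  rewrite (moment_odd (j := k)) ?mulr0 // /incr_at lj eq_sym (negPf jk) addn0 //.
by rewrite (moment_odd (j := j)) ?mulr0 // /incr_at eq_sym (negPf lj) addn0.
Qed.

End FirstOrder.

(** * Remainder estimates *)

Section Asymptotics.
Context {R : realType} {m : nat}.
Notation n := m.+2.
Implicit Types (alpha : 'I_n -> nat) (xi : 'rV[R]_n).
Notation normc := ComplexField.Normc.normc.

Definition fourier_integral alpha xi : R[i] :=
  csphere_integral (fun x : 'rV[R]_n => (monomial alpha x)%:C * expi (- dotrv x xi)).

Let continuous_mulr (T : topologicalType) (f g : T -> R) :
  continuous f -> continuous g -> continuous (fun x => f x * g x).
Proof. by move=> cf cg x; exact: (cvgM (cf x) (cg x)). Qed.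

Lemma continuous_dotrv xi : continuous (fun x : 'rV[R]_n => dotrv x xi).
Proof.
apply: continuous_sumr => j; apply: continuous_mulr; last exact: cst_continuous.
exact: continuous_coord.
Qed.

Lemma norm_dotrv_le (x : 'rV[R]_n) xi : (forall j, `|x 0 j| <= 1) ->
  `|dotrv x xi| <= n%:R * enorm xi.
Proof.
move=> x1; rewrite (le_trans (ler_norm_sum _ _ _)) //.
rewrite (le_trans (ler_sum _ (G := fun _ => enorm xi) _)) //.
  by move=> j _; rewrite normrM (le_trans _ (coord_le_enorm xi j)) // ler_piMl.
by rewrite sumr_const card_ord mulr_natl.
Qed.

Lemma norm_monomial_le1 alpha (x : 'rV[R]_n) : (forall j, `|x 0 j| <= 1) ->
  `|monomial alpha x| <= 1.
Proof.
move=> x1; rewrite /monomial; elim/big_ind: _ => [|a b ha hb|j _].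
- by rewrite normr1.
- by rewrite normrM mulr_ile1.
- by rewrite normrX exprn_ile1.
Qed.

Lemma fourier_integralE alpha xi : fourier_integral alpha xi =
  sphere_integral (fun x : 'rV[R]_n => monomial alpha x * cos (dotrv x xi)) +i*
  sphere_integral (fun x : 'rV[R]_n => monomial alpha x * - sin (dotrv x xi)).
Proof.
by congr (_ +i* _); congr sphere_integral; apply/funext => x;
  rewrite /= cosN sinN; ring.
Qed.

(** With d = x.xi the remainders are x^alpha (cos d - 1) and x^alpha (d - sin d), both at most d^2
    <= n^2 |xi|^2 on the cube. The factor 2 adds real and imaginary parts. *)
Lemma fourier_integral_first_order alpha xi :
  normc (fourier_integral alpha xi - first_order alpha xi) <=
  2 * n%:R ^+ 2 * sphere_box_volume (R := R) n.-1 * enorm xi ^+ 2.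
Proof.
pose f : 'rV[R]_n -> R := monomial alpha; pose d x := dotrv x xi.
have cf : continuous f by exact: continuous_monomial.
have cd : continuous d by exact: continuous_dotrv.
have cP : continuous (fun x => f x * cos (d x)).
  apply: continuous_mulr => // x.
  by apply: (continuous_comp (f := d) (g := cos)); [exact: cd|exact: continuous_cos].
have cQ : continuous (fun x => f x * - sin (d x)).
  apply: continuous_mulr => // x.
  apply: (continuous_comp (f := d) (g := fun t => - sin t)); first exact: cd.
  exact: (cvgN (@continuous_sin R _)).
have cZ k (g : 'rV[R]_n -> R) : continuous g -> continuous (fun x => k * g x).
  by apply: continuous_mulr; exact: cst_continuous.
have bound (t : R) g : `|g| <= t ^+ 2 -> forall x : 'rV[R]_n, 
    (forall j, `|x 0 j| <= 1) -> `|t| <= n%:R * enorm xi -> 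
    `|f x * g| <= n%:R ^+ 2 * enorm xi ^+ 2.
  move=> gt x x1 td; rewrite normrM (le_trans (ler_piMl _ (norm_monomial_le1 _ x1))) //.
  rewrite (le_trans gt) // -exprMn -(real_normK (num_real t)) lerXn2r ?nnegrE //.
  by rewrite (le_trans _ td).
have bRe : `|sphere_integral (fun x => f x * cos (d x)) - sphere_integral f| <=
    n%:R ^+ 2 * enorm xi ^+ 2 * sphere_box_volume (R := R) n.-1.
  rewrite -[X in _ - X]mul1r -mulNr -sphere_integralZl // -sphere_integralD //; last exact: cZ.
  apply: sphere_integral_bound.
    by move=> x; apply: (cvgD (cP x)); exact: cZ.
  move=> x x1; have -> : f x * cos (d x) + -1 * f x = f x * (cos (d x) - 1) by ring.
  by apply: (bound (d x)) => //; [exact: norm_cosB1_sqr|exact: norm_dotrv_le].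
pose g x := \sum_j xi 0 j * monomial (incr_at alpha j) x.
have cg : continuous g.
  by apply: continuous_sumr => j; apply: cZ; exact: continuous_monomial.
have gE : \sum_j xi 0 j * sphere_integral (monomial (incr_at alpha j) : 'rV[R]_n -> R) =
    sphere_integral g.
  rewrite sphere_integral_sum; last by move=> j; apply: cZ; exact: continuous_monomial.
  by apply: eq_bigr => j _; rewrite sphere_integralZl //; exact: continuous_monomial.
have bIm : `|sphere_integral (fun x => f x * - sin (d x)) -
      - \sum_j xi 0 j * sphere_integral (monomial (incr_at alpha j) : 'rV[R]_n -> R)| <=
    n%:R ^+ 2 * enorm xi ^+ 2 * sphere_box_volume (R := R) n.-1.
  rewrite opprK gE -sphere_integralD //; apply: sphere_integral_bound.
    by move=> x; exact: (cvgD (cQ x) (cg x)).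
  move=> x x1; have -> : f x * - sin (d x) + g x = f x * (d x - sin (d x)).
    rewrite mulrBr mulrN addrC; congr (_ - _); rewrite /g /d /dotrv mulr_sumr.
    by apply: eq_bigr => j _; rewrite monomial_incr_at /f; ring.
  by apply: (bound (d x)) => //; [exact: norm_sinB_sqr|exact: norm_dotrv_le].
rewrite fourier_integralE (le_trans (normc_le _ _)) // (le_trans (lerD bRe bIm)) //.
by rewrite le_eqVlt; apply/orP; left; apply/eqP; ring.
Qed.

Lemma fourier_integral_bound alpha (nu : R) :
  nu = (n%:R + (mlength alpha)%:R + (mu (mono_odd alpha))%:R - 2) / 2 ->
  exists C, forall xi, enorm xi <= 1 ->
    normc (fourier_integral alpha xi - A_coef alpha xi * (Psi nu xi)%:C) <=
    C * enorm xi ^+ 2.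
Proof.
move=> nuE; pose D := [set j | odd (alpha j)]%SET.
pose a : R := `|(2 * pi) `^ (n%:R / 2) * doublefact_weight alpha|.
have a0 : 0 <= a by exact: normr_ge0.
pose Psi0 : R := Psi nu (0 : 'rV[R]_n).
have nu0 : 0 <= nu.
  by rewrite nuE divr_ge0 // subr_ge0 -addrA ler_wpDr ?addr_ge0 // ler_nat.
have g0 : 0 < Gamma (nu + 1).
  have -> : nu + 1 = (n + (mlength alpha + mu (mono_odd alpha)))%:R / 2.
    by rewrite nuE !natrD; field.
  exact: half_Gamma_gt0.
pose c1 := 2 * n%:R ^+ 2 * sphere_box_volume (R := R) n.-1.
pose c3 := 2 `^ (- nu) * (Gamma (nu + 1))^-1 * expR 1.
(* One constant per difference in the decomposition below: the Taylor remainder, the mismatch at the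
   origin (nonzero only for several odd exponents), and the variation of Psi. *)
exists (c1 + a * `|Psi0| + a * c3) => xi xi1.
have e0 : 0 <= enorm xi by exact: sqrtr_ge0.
have normA : normc (A_coef alpha xi) <= a * enorm xi ^+ #|D| by exact: normc_A_coef_le.
have -> : fourier_integral alpha xi - A_coef alpha xi * (Psi nu xi)%:C =
    (fourier_integral alpha xi - first_order alpha xi) +
    (first_order alpha xi - A_coef alpha xi * Psi0%:C) +
    A_coef alpha xi * (Psi0 - Psi nu xi)%:C.
  by rewrite rmorphB /= mulrBr !addrA !subrK.
rewrite (le_trans (le_normcD _ _)) // !mulrDl lerD //; last first.
  rewrite ComplexField.Normc.normcM normc_real distrC -mulrA ler_pM ?normr_ge0 //.
  - exact: normc_ge0.
  - by rewrite (le_trans normA) // -[Y in _ <= Y]mulr1 ler_wpM2l // exprn_ile1.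
  - exact: Psi_near0.
rewrite (le_trans (le_normcD _ _)) // lerD //; first exact: fourier_integral_first_order.
(* With two odd exponents, A_coef has |D| >= 2 factors of size |xi|. *)
have [D1|D2] := leqP #|D| 1.
  rewrite (first_order_eq nuE) // subrr ComplexField.Normc.normc0.
  by rewrite mulr_ge0 ?exprn_ge0 // mulr_ge0.
rewrite first_order_eq0 // sub0r normcN ComplexField.Normc.normcM normc_real mulrAC.
rewrite ler_wpM2r // (le_trans normA) // ler_wpM2l //.
by rewrite -(subnK D2) exprD ler_piMl ?exprn_ge0 // exprn_ile1.
Qed.

End Asymptotics.

(** The filter at 0 comes from the sup norm; this carries the limit over to the Euclidean norm. *)
Lemma cvg_enorm0 {R : realType} n : enorm xi @[xi --> (0 : 'rV[R]_n)] --> (0 : R).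
Proof.
have <- : enorm (0 : 'rV[R]_n) = 0.
  by rewrite /enorm big1 ?sqrtr0 // => j _; rewrite mxE expr0n.
apply: (continuous_comp (f := fun x : 'rV[R]_n => \sum_j x 0 j ^+ 2) (g := Num.sqrt)).
  apply: continuous_sumr => j x.
  apply: (continuous_comp (f := fun x : 'rV[R]_n => x 0 j) (g := fun t : R => t ^+ 2)).
    exact: continuous_coord.
  exact: exprn_continuous.
exact: sqrt_continuous.
Qed.

Unset Implicit Arguments.

Theorem theorem4p1 (R : realType) (n : nat) (hn : (3 <= n)%N)
    (alpha : 'I_n -> nat) :
  let nu : R :=
    (n%:R + (mlength alpha)%:R + (mu (mono_odd alpha))%:R - 2) / 2 in
  ComplexField.Normc.normc
    (csphere_integral
       (fun x : 'rV[R]_n => (monomial alpha x)%:C * expi (- dotrv x xi))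
     - A_coef alpha xi * (Psi nu xi)%:C)
  / enorm xi @[xi --> (0 : 'rV[R]_n)^'] --> (0 : R).
Proof.
case: n hn alpha => [//|[//|m]] _ alpha nu.
have [C hC] := fourier_integral_bound (erefl nu).
have cE : enorm xi @[xi --> (0 : 'rV[R]_m.+2)^'] --> (0 : R).
  by apply: cvg_within_filter; exact: cvg_enorm0.
(* Dividing the quadratic bound by |xi| leaves C |xi|; the punctured neighbourhood provides xi !=
   0. *)
apply: (@squeeze_cvgr _ _ _ _ (cst 0) (fun xi => C * enorm xi)).
- near=> xi.
  have xi0 : 0 < enorm xi by apply: enorm_gt0; near: xi; exact: nbhs_dnbhs_neq.
  rewrite /= divr_ge0 ?normc_ge0 ?(ltW xi0) //= ler_pdivrMr // -[C * _ * _]mulrA -expr2; apply: hC.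
  near: xi; move/cvgrPdist_le: cE => /(_ 1 ltr01); apply: filterS => xi.
  by rewrite sub0r normrN ger0_norm // sqrtr_ge0.
- exact: cvg_cst.
- rewrite -[X in _ --> X](mulr0 C); apply: cvgM; first exact: cvg_cst.
  exact: cE.
Unshelve. all: by end_near. Qed.
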